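(* Let $r>1$ be an integer. Let $\Gamma\subset\mathbb R^2$ be a curve of class $C^1$, and let $f:\mathbb R^2\to\mathbb R$ be a continuous function that is sufficiently regular outside $\Gamma$ and for which $\Gamma$ is a singularity curve (both notions as defined in the context). Fix $\xi\in\Gamma$ and a constant $C>0$. For a mesh size $\Delta>0$ put $\delta=C\Delta$ and $B=B_\delta(\xi)$, and let $j,i\in\mathbb Z$ be any indices (allowed to depend on $\Delta$) such that all the stencils $\mathcal S_{k,w}$, $0\le k,w\le r-1$, associated with $(j,i)$ are contained in $B$. Assume that, for all sufficiently small $\Delta$, at every point $(x,y)\in B\setminus\Gamma$ at least one of the second-order partial derivatives of $f$ is non-zero. Let $$\beta_{k,w}=\beta(f)_{k,w}=\sum_{\substack{0\le\alpha_1,\alpha_2\le r\\ \alpha_1+\alpha_2\ge 2}}\int_{x_{j-1}}^{x_j}\int_{y_{i-1}}^{y_i}\Delta^{\gamma_1}\Delta^{\gamma_2}\left(\partial_x^{\alpha_1}\partial_y^{\alpha_2}P_{k,w}(x,y)\right)^2\,dx\,dy,$$ with $\gamma_1=2(\alpha_1-1)$ and $\gamma_2=2(\alpha_2-1)$. Then, for every $k=0,\dots,r-1$ and $w=0,\dots,r-1$, as $\Delta\to0$: (i) if $\Gamma\cap\overline{\mathcal S}_{k,w}=\emptyset$, then $\beta(f)_{k,w}=O(\Delta^2)$; (ii) if $\Gamma\cap\overline{\mathcal S}_{k,w}\neq\emptyset$, then $\beta(f)_{k,w}=O(1)$.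
   Context: Grid: uniform Cartesian grid of the plane with equal spacing $\Delta>0$ in both directions, $x_j=j\Delta$, $y_i=i\Delta$, $j,i\in\mathbb Z$. Stencils: for given indices $(j,i)$ and $0\le k,w\le r-1$, $\mathcal S_{k,w}=\{x_{j+k-r},\dots,x_{j+k}\}\times\{y_{i+w-r},\dots,y_{i+w}\}$ (a set of $(r+1)^2$ grid points) and $\overline{\mathcal S}_{k,w}=[x_{j+k-r},x_{j+k}]\times[y_{i+w-r},y_{i+w}]$. Each $\overline{\mathcal S}_{k,w}$ contains the cell $[x_{j-1},x_j]\times[y_{i-1},y_i]$. Interpolating polynomial: $P_{k,w}$ is the unique polynomial of degree at most $r$ in each of the variables $x$ and $y$ (i.e. in $\mathbb Q_r(\mathbb R^2)$) that coincides with $f$ at all points of $\mathcal S_{k,w}$. Curve: $\Gamma$ is parametrized by $s\mapsto(x(s),y(s))$. ''$\Gamma$ of class $C^1$'' means that the parametrization is $C^1$ with non-vanishing derivative, so that unit tangent and normal vectors are defined at every point of $\Gamma$. For $\xi\in\Gamma$ and $\delta>0$ small, $B_\delta(\xi)$ is the ball of centre $\xi$ and radius $\delta$, and $\Gamma$ divides it into two parts $B^-_\delta(\xi)$ and $B^+_\delta(\xi)$, with $B^-_\delta(\xi)\cup B^+_\delta(\xi)=B_\delta(\xi)\setminus\Gamma$. One-sided gradients: $\nabla^{\pm}f(\xi)=\lim_{(x,y)\to\xi,\ (x,y)\in B^{\pm}_\delta(\xi)}\nabla f(x,y)$. Singularity curve: a continuous curve $\Gamma$ is a singularity curve for a continuous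 function $f$ if, for every $\xi\in\Gamma$, $f\in C^k(B_\delta(\xi)\setminus\Gamma)$ for some $k\ge1$ (with $\delta$ small) and $\mathcal D(\xi):=\nabla^+f(\xi)-\nabla^-f(\xi)\ne(0,0)$. ''Sufficiently regular outside $\Gamma$'': $f$ is of class $C^m$ on $\mathbb R^2\setminus\Gamma$ for an integer $m$ large enough depending only on $r$ (e.g. $m=2r+1$), and near each point of $\Gamma$ its partial derivatives of order at most $m$ extend continuously up to $\Gamma$ from each of the two sides. Asymptotics: the $O(\cdot)$ bounds are as $\Delta\to0$ with $f$, $\Gamma$, $\xi$, $r$, $C$ fixed; the implied constants do not depend on $\Delta$ or on the choice of $(j,i)$. *)

(* Defs.v *)
From Stdlib Require Export Reals ZArith.
From Coquelicot Require Export Coquelicot.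

Open Scope R_scope.

(* Euclidean open disc; Coquelicot's [ball] on [R * R] is a square. *)
Definition disc (xi : R * R) (delta : R) (p : R * R) : Prop :=
  (fst p - fst xi) ^ 2 + (snd p - snd xi) ^ 2 < delta ^ 2.

Definition connected_set (A : R * R -> Prop) : Prop :=
  forall U V : R * R -> Prop,
    open U -> open V ->
    (forall p, A p -> U p \/ V p) ->
    (exists p, A p /\ U p) -> (exists p, A p /\ V p) ->
    exists p, A p /\ U p /\ V p.

(* The open parameter interval may be unbounded, so closed curves are covered
   by their periodic parametrizations. *)
Definition C1_curve (Gamma : R * R -> Prop) : Prop :=
  exists (a b : Rbar) (x y : R -> R),
    Rbar_lt a b /\
    (forall s : R, Rbar_lt a s -> Rbar_lt s b ->
       ex_derive x s /\ ex_derive y s /\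
       continuous (Derive x) s /\ continuous (Derive y) s /\
       (Derive x s, Derive y s) <> (0, 0)) /\
    (forall p, Gamma p <->
       exists s : R, Rbar_lt a s /\ Rbar_lt s b /\ p = (x s, y s)).

(* [Bm] and [Bp] are the two parts into which [Gamma] divides the disc, that is,
   the two connected components of the disc minus [Gamma]. *)
Definition divides (Gamma : R * R -> Prop) (xi : R * R) (delta : R)
    (Bm Bp : R * R -> Prop) : Prop :=
  open Bm /\ open Bp /\
  (exists p, Bm p) /\ (exists p, Bp p) /\
  connected_set Bm /\ connected_set Bp /\
  (forall p, ~ (Bm p /\ Bp p)) /\
  (forall p, Bm p \/ Bp p <-> disc xi delta p /\ ~ Gamma p).

(* [ex_diff_n f n x y] is a condition at the single point [(x, y)].  For open [U]
   this is the usual C^n(U); otherwise it is C^n on the interior of [U]. *)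
Definition class_C (n : nat) (f : R -> R -> R) (U : R * R -> Prop) : Prop :=
  forall p : R * R, locally p U -> ex_diff_n f n (fst p) (snd p).

Definition gradient (f : R -> R -> R) (p : R * R) : R * R :=
  (partial_derive 1 0 f (fst p) (snd p), partial_derive 0 1 f (fst p) (snd p)).

Definition is_one_sided_gradient (f : R -> R -> R) (xi : R * R)
    (B : R * R -> Prop) (g : R * R) : Prop :=
  filterlim (gradient f) (within B (locally xi)) (locally g).

Definition singularity_curve (Gamma : R * R -> Prop) (f : R -> R -> R) : Prop :=
  forall xi, Gamma xi ->
  exists delta0, 0 < delta0 /\
  forall delta, 0 < delta < delta0 ->
    (exists k : nat, (1 <= k)%nat /\
       class_C k f (fun p => disc xi delta p /\ ~ Gamma p)) /\
    exists Bm Bp, divides Gamma xi delta Bm Bp /\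
    exists gm gp : R * R,
      is_one_sided_gradient f xi Bm gm /\
      is_one_sided_gradient f xi Bp gp /\
      (fst gp - fst gm, snd gp - snd gm) <> (0, 0).

(* All partial derivatives of order at most [m], defined on [B], extend to
   continuous functions on [B] together with [E]. *)
Definition derivatives_extend (m : nat) (f : R -> R -> R)
    (B E : R * R -> Prop) : Prop :=
  forall a1 a2 : nat, (a1 + a2 <= m)%nat ->
  exists g : R * R -> R,
    (forall p, B p -> g p = partial_derive a1 a2 f (fst p) (snd p)) /\
    (forall p, B p \/ E p ->
       filterlim g (within (fun q => B q \/ E q) (locally p)) (locally (g p))).

Definition regular_outside (m : nat) (Gamma : R * R -> Prop)
    (f : R -> R -> R) : Prop :=
  class_C m f (fun p => ~ Gamma p) /\
  forall xi, Gamma xi ->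
  exists delta Bm Bp,
    0 < delta /\ divides Gamma xi delta Bm Bp /\
    derivatives_extend m f Bm (fun p => Gamma p /\ disc xi delta p) /\
    derivatives_extend m f Bp (fun p => Gamma p /\ disc xi delta p).

Definition grid (Delta : R) (n : Z) : R := IZR n * Delta.

Definition stencil (r : nat) (Delta : R) (j i : Z) (k w : nat)
    (p : R * R) : Prop :=
  exists l n : Z,
    (j + Z.of_nat k - Z.of_nat r <= l <= j + Z.of_nat k)%Z /\
    (i + Z.of_nat w - Z.of_nat r <= n <= i + Z.of_nat w)%Z /\
    p = (grid Delta l, grid Delta n).

Definition stencil_hull (r : nat) (Delta : R) (j i : Z) (k w : nat)
    (p : R * R) : Prop :=
  grid Delta (j + Z.of_nat k - Z.of_nat r) <= fst p
    <= grid Delta (j + Z.of_nat k) /\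
  grid Delta (i + Z.of_nat w - Z.of_nat r) <= snd p
    <= grid Delta (i + Z.of_nat w).

Definition in_Q (r : nat) (P : R -> R -> R) : Prop :=
  exists c : nat -> nat -> R, forall x y : R,
    P x y = sum_n (fun a => sum_n (fun b => c a b * x ^ a * y ^ b) r) r.

Definition interpolates (r : nat) (f : R -> R -> R) (S : R * R -> Prop)
    (P : R -> R -> R) : Prop :=
  in_Q r P /\ forall p, S p -> P (fst p) (snd p) = f (fst p) (snd p).

(* The exponents 2 (a - 1) are integers and equal -2 when a = 0. *)
Definition beta (r : nat) (Delta : R) (j i : Z) (P : R -> R -> R) : R :=
  sum_n (fun a1 => sum_n (fun a2 =>
    if (2 <=? a1 + a2)%nat then
      RInt (fun x => RInt (fun y =>
          powerRZ Delta (2 * (Z.of_nat a1 - 1))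
          * powerRZ Delta (2 * (Z.of_nat a2 - 1))
          * (partial_derive a1 a2 P x y) ^ 2)
        (grid Delta (i - 1)) (grid Delta i))
        (grid Delta (j - 1)) (grid Delta j)
    else 0) r) r.

(* Main.v *)
Require Import Defs.
From Stdlib Require Import Cantor Lra Lia List Classical ClassicalEpsilon.

(* In the coordinates [(x - X) / Delta, (y - Y) / Delta] every term of [beta] is
   [Delta ^ (-2)] times the squared L2 norm, over a unit cell, of a derivative of
   order at least two of the rescaled interpolant.  Such a derivative is unchanged
   when an affine function is subtracted from [f], so by Lagrange interpolation
   [beta = O(eps ^ 2 / Delta ^ 2)] as soon as [f] is within [eps] of an affine function
   on the stencil.

   If the hull of the stencil avoids the curve, take the first-order Taylor polynomial
   at a corner: [eps = O(Delta ^ 2)].  Otherwise take the constant [f(xi)]: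
   [eps = O(Delta)], because [f] is Lipschitz near [xi].  The latter is delicate, since a
   line may meet a C^1 curve in an uncountable set.  By the one-dimensional Sard theorem a
   dense set of horizontal lines meets the curve only at isolated parameters; along these
   lines the bound on the derivative off the curve gives the Lipschitz estimate, which
   extends to all horizontal lines by continuity of [f].  Vertical lines are symmetric. *)

(** * Nowhere dense sets and critical values *)

(** The missed interval is closed and strictly inside [(u, v)], the form in which the nested
    intervals of [baire] use it; this amounts to the usual notion, that the interior of the
    complement is dense. *)
Definition nowhere_dense (K : R -> Prop) : Prop :=
  forall u v, u < v ->
  exists u' v', u < u' /\ u' < v' /\ v' < v /\ forall t, u' <= t <= v' -> ~ K t.

Lemma nowhere_dense_subset (K L : R -> Prop) :
  (forall t, K t -> L t) -> nowhere_dense L -> nowhere_dense K.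
Proof.
  intros H HL u v Huv. destruct (HL u v Huv) as (u' & v' & ? & ? & ? & Hn).
  exists u', v'. repeat split; auto. intros t Ht Kt. exact (Hn t Ht (H t Kt)).
Qed.

Lemma nowhere_dense_subsingleton (K : R -> Prop) :
  (forall s t, K s -> K t -> s = t) -> nowhere_dense K.
Proof.
  intros H u v Huv.
  destruct (classic (exists t, K t /\ t < (u + v) / 2)) as [(t & Kt & Ht) | Hn].
  - exists ((u + v) / 2), (u / 4 + 3 * v / 4). repeat split; try lra.
    intros s Hs Ks. rewrite (H s t Ks Kt) in Hs. lra.
  - exists (3 * u / 4 + v / 4), (5 * u / 8 + 3 * v / 8). repeat split; try lra.
    intros s Hs Ks. apply Hn. exists s. split; [exact Ks | lra].
Qed.

(** Nested intervals: stage [n] passes to a closed subinterval missed by [K n], and the supremum of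
    the left ends belongs to every stage. *)
Lemma baire (K : nat -> R -> Prop) :
  (forall n, nowhere_dense (K n)) ->
  forall u v, u < v -> exists t, u < t < v /\ forall n, ~ K n t.
Proof.
  intros HK u v Huv.
  set (I := {p : R * R | fst p < snd p}).
  assert (step : forall (n : nat) (p : I), {q : I |
    fst (proj1_sig p) < fst (proj1_sig q) /\
    snd (proj1_sig q) < snd (proj1_sig p) /\
    forall t, fst (proj1_sig q) <= t <= snd (proj1_sig q) -> ~ K n t}).
  { intros n [[a b] Hab]. apply constructive_indefinite_description.
    destruct (HK n a b Hab) as (a' & b' & H1 & H2 & H3 & H4).
    exists (exist _ (a', b') H2). simpl. auto. }
  set (J := fix J n : I := match n with
    | O => exist _ (u, v) Huv | S n => proj1_sig (step n (J n)) end).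
  set (lo := fun n => fst (proj1_sig (J n))).
  set (hi := fun n => snd (proj1_sig (J n))).
  assert (HS : forall n, lo n < lo (S n) /\ hi (S n) < hi n /\
    forall t, lo (S n) <= t <= hi (S n) -> ~ K n t).
  { intros n. unfold lo, hi. simpl. exact (proj2_sig (step n (J n))). }
  assert (Hlh : forall n, lo n < hi n) by (intros n; exact (proj2_sig (J n))).
  assert (mono : forall n m, lo n <= lo (n + m)%nat /\ hi (n + m)%nat <= hi n).
  { intros n m. induction m as [|m IH].
    - rewrite Nat.add_0_r. lra.
    - rewrite Nat.add_succ_r. destruct (HS (n + m)%nat). lra. }
  assert (cross : forall n m, lo n < hi m).
  { intros n m. destruct (mono n m). destruct (mono m n) as [_ H1].
    rewrite Nat.add_comm in H1. specialize (Hlh (n + m)%nat). lra. }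
  destruct (completeness (fun z => exists n, z = lo n)) as [t [Hub Hlub]].
  { exists v. intros z [n ->]. left. exact (cross n O). }
  { exists (lo O). exists O. reflexivity. }
  assert (Hlo : forall n, lo n <= t) by (intros n; apply Hub; exists n; reflexivity).
  assert (Hhi : forall n, t <= hi n).
  { intros n. apply Hlub. intros z [m ->]. left. apply cross. }
  exists t. split.
  - destruct (HS O) as (H1 & H2 & _). specialize (Hlo 1%nat). specialize (Hhi 1%nat).
    change (lo O) with u in H1. change (hi O) with v in H2. lra.
  - intros n. apply (HS n). split; auto.
Qed.

(** A countable base of the line: [n] codes a triple through the Cantor pairing, and the difference
    of two naturals gives a signed numerator. *)
Definition basic_interval (n : nat) (t : R) : Prop :=
  let (p, c) := of_nat n in let (a, b) := of_nat p in
  Rabs (t - (INR a - INR b) / (INR c + 1)) < / (INR c + 1).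

Lemma basic_interval_small (s d : R) :
  0 < d ->
  exists n, basic_interval n s /\ forall t, basic_interval n t -> Rabs (t - s) < d.
Proof.
  intros Hd.
  destruct (nfloor_ex (2 / d)) as [c Hc].
  { apply Rlt_le, Rdiv_lt_0_compat; lra. }
  assert (Hc0 : 0 < INR c + 1) by (generalize (pos_INR c); lra).
  assert (Hcd : 2 * / (INR c + 1) < d).
  { apply (Rmult_lt_reg_r (INR c + 1)); [lra|].
    replace (2 * / (INR c + 1) * (INR c + 1)) with 2 by (field; lra).
    apply (Rmult_lt_reg_r (/ d)); [apply Rinv_0_lt_compat; lra|].
    replace (d * (INR c + 1) * / d) with (INR c + 1) by (field; lra).
    unfold Rdiv in Hc. lra. }
  (* The centre [k / (c + 1)] is [s] rounded down to the mesh [1 / (c + 1)], so [s] is within the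
     radius of it, and two points of the interval are less than [2 / (c + 1) < d] apart. *)
  set (k := Int_part (s * (INR c + 1))).
  destruct (base_Int_part (s * (INR c + 1))) as [Hk1 Hk2]. fold k in Hk1, Hk2.
  exists (to_nat (to_nat (Z.to_nat k, Z.to_nat (- k)), c)).
  assert (E : INR (Z.to_nat k) - INR (Z.to_nat (- k)) = IZR k).
  { rewrite !INR_IZR_INZ, <- minus_IZR. f_equal. lia. }
  unfold basic_interval. rewrite !cancel_of_to, E.
  assert (Hs : Rabs (s - IZR k / (INR c + 1)) < / (INR c + 1)).
  { replace (s - IZR k / (INR c + 1))
      with ((s * (INR c + 1) - IZR k) * / (INR c + 1)) by (field; lra).
    assert (0 < / (INR c + 1)) by (apply Rinv_0_lt_compat; lra).
    rewrite Rabs_pos_eq by (apply Rmult_le_pos; lra).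
    rewrite <- (Rmult_1_l (/ (INR c + 1))) at 2.
    apply Rmult_lt_compat_r; lra. }
  split; [exact Hs|].
  intros t Ht.
  apply Rabs_def2 in Hs. apply Rabs_def2 in Ht. apply Rabs_def1; lra.
Qed.

(** Every point of [D] lies in a basic interval on which the image is nowhere dense. There are
    countably many such intervals, so [baire] applies. *)
Lemma avoid_locally_nowhere_dense_image (D : R -> Prop) (g : R -> R) :
  (forall s, D s -> exists d, 0 < d /\
     nowhere_dense (fun z => exists t, D t /\ Rabs (t - s) < d /\ z = g t)) ->
  forall u v, u < v -> exists z, u < z < v /\ forall s, D s -> g s <> z.
Proof.
  intros H u v Huv.
  set (L := fun n z => exists t, D t /\ basic_interval n t /\ z = g t).
  (* The conjunct [nowhere_dense (L n)] empties the bad sets [L n], so that the family can be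
     indexed by all naturals. *)
  destruct (baire (fun n z => nowhere_dense (L n) /\ L n z)) with (2 := Huv)
    as (z & Hz & Hn).
  - intros n. destruct (classic (nowhere_dense (L n))) as [h | h].
    + apply nowhere_dense_subset with (2 := h). tauto.
    + apply nowhere_dense_subsingleton. tauto.
  - exists z. split; [exact Hz|]. intros s Ds E.
    destruct (H s Ds) as (d & Hd & Hnd).
    destruct (basic_interval_small s d Hd) as (n & Hn1 & Hn2).
    apply (Hn n). split.
    + apply nowhere_dense_subset with (2 := Hnd).
      intros y (t & ? & ? & ?). exists t. auto.
    + exists s. auto.
Qed.

(** Read [A i l] as: piece [i] hits slot [l]. If all [N + 1] slots were hit, choosing a piece for
    each would inject them into [N] pieces. *)
Lemma pigeonhole_unhit (N : nat) (A : nat -> nat -> Prop) :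
  (forall i l l', A i l -> A i l' -> l = l') ->
  exists l, (l <= N)%nat /\ forall i, (i < N)%nat -> ~ A i l.
Proof.
  intros Hinj. apply NNPP. intros Hn.
  assert (hit : forall l, exists i, (l <= N)%nat -> (i < N)%nat /\ A i l).
  { intros l. destruct (classic (exists i, (i < N)%nat /\ A i l)) as [[i Hi] | h].
    - exists i. auto.
    - exists O. intros Hl. exfalso. apply Hn. exists l. split; [exact Hl|].
      intros i Hi Ai. apply h. exists i. auto. }
  set (g := fun l => proj1_sig (constructive_indefinite_description _ (hit l))).
  assert (Hg : forall l, (l <= N)%nat -> (g l < N)%nat /\ A (g l) l).
  { intros l. exact (proj2_sig (constructive_indefinite_description _ (hit l))). }
  assert (Hle : (length (map g (seq 0 (S N))) <= length (seq 0 N))%nat).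
  { apply NoDup_incl_length.
    - apply NoDup_map_NoDup_ForallPairs; [|apply seq_NoDup].
      intros l l' Hl Hl' E. apply in_seq in Hl, Hl'.
      apply (Hinj (g l)); [|rewrite E]; apply Hg; lia.
    - intros i Hi. apply in_map_iff in Hi. destruct Hi as (l & <- & Hl).
      apply in_seq in Hl. apply in_seq. destruct (Hg l); lia. }
  rewrite length_map, !length_seq in Hle. lia.
Qed.

(* One-dimensional Sard theorem: cut the segment into [N] pieces on which the
   derivative oscillates little.  The critical values on one piece have diameter
   smaller than the gaps between [N + 1] disjoint subintervals of [(u, v)], so
   one of these subintervals contains no critical value. *)
Lemma critical_values_nowhere_dense (g : R -> R) (c l : R) :
  0 < l ->
  (forall t, c <= t <= c + l -> ex_derive g t /\ continuous (Derive g) t) ->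
  nowhere_dense (fun z => exists t, c <= t < c + l /\ Derive g t = 0 /\ z = g t).
Proof.
  intros Hl Hg u v Huv.
  (* Tolerance for the derivative: over a piece of length [l / N] it allows a variation of
     [(v - u) / (8 N)], which is less than the [w] below because [2 N + 3 < 8 N]. *)
  assert (He : 0 < (v - u) / (8 * l)) by (apply Rdiv_lt_0_compat; lra).
  destruct (unifcont_1d (Derive g) c (c + l)
    (fun t Ht => proj2 (Hg t Ht)) (mkposreal _ He)) as [d Hd].
  destruct (nfloor_ex (l / d)) as [N0 HN0].
  { apply Rlt_le, Rdiv_lt_0_compat; [lra | apply cond_pos]. }
  set (N := S N0).
  assert (HN : INR N = INR N0 + 1) by apply S_INR.
  assert (HN1 : 1 <= INR N) by (generalize (pos_INR N0); lra).
  assert (HlN : l / INR N < d).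
  { generalize (cond_pos d). intros Hd0.
    apply (Rmult_lt_reg_r (INR N)); [lra|].
    replace (l / INR N * INR N) with l by (field; lra).
    apply (Rmult_lt_reg_r (/ d)); [apply Rinv_0_lt_compat; lra|].
    replace (d * INR N * / d) with (INR N) by (field; lra).
    unfold Rdiv in HN0. lra. }
  (* Cut [[u, v]] into [2 N + 3] cells of width [w]; the slots [J p], [p <= N], are every second
     cell, so they are at mutual distance at least [w]. *)
  set (w := (v - u) / (2 * INR N + 3)).
  assert (Hw0 : 0 < w) by (apply Rdiv_lt_0_compat; lra).
  assert (Hw : w * (2 * INR N + 3) = v - u) by (unfold w; field; lra).
  set (crit := fun t => c <= t < c + l /\ Derive g t = 0).
  set (piece := fun i t => c + INR i * (l / INR N) <= t <= c + (INR i + 1) * (l / INR N)).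
  set (J := fun p z => u + (2 * INR p + 1) * w <= z <= u + (2 * INR p + 2) * w).
  assert (Hq0 : 0 < l / INR N) by (apply Rdiv_lt_0_compat; lra).
  assert (diam : forall i t t', piece i t -> piece i t' -> crit t -> crit t' ->
    Rabs (g t - g t') < w).
  { intros i t t' Ht Ht' [Ct Dt] [Ct' Dt'].
    destruct (MVT_gen g t' t (Derive g)) as (z & Hz & Ez).
    - intros z Hz. apply Derive_correct, Hg.
      unfold Rmin, Rmax in Hz. destruct (Rle_dec t' t); lra.
    - intros z Hz.
      apply continuity_pt_filterlim, (ex_derive_continuous g), Hg.
      unfold Rmin, Rmax in Hz. destruct (Rle_dec t' t); lra.
    - rewrite Ez, Rabs_mult.
      assert (Hz' : t' <= z <= t \/ t <= z <= t').
      { unfold Rmin, Rmax in Hz. destruct (Rle_dec t' t); lra. }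
      unfold piece in Ht, Ht'.
      assert (H1 : Rabs (Derive g z) < (v - u) / (8 * l)).
      (* [unifcont_1d] gives a doubly negated conclusion. It compares [z] with the critical point
         [t], where the derivative vanishes. *)
      { apply NNPP. intros Hn. apply (Hd t z); [lra | lra | |].
        - apply Rabs_def1; unfold minus, plus, opp; simpl; lra.
        - intros Hb. apply Hn. unfold ball in Hb. simpl in Hb.
          unfold AbsRing_ball, abs, minus, plus, opp in Hb. simpl in Hb.
          rewrite Dt, Ropp_0, Rplus_0_r in Hb. exact Hb. }
      assert (H2 : Rabs (t - t') <= l / INR N) by (apply Rabs_le; lra).
      apply Rle_lt_trans with ((v - u) / (8 * l) * (l / INR N)).
      + apply Rmult_le_compat; try apply Rabs_pos; lra.
      + rewrite <- Hw.
        replace (w * (2 * INR N + 3) / (8 * l) * (l / INR N))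
          with (w * ((2 * INR N + 3) / (8 * INR N))) by (field; lra).
        rewrite <- (Rmult_1_r w) at 2. apply Rmult_lt_compat_l; [lra|].
        apply (Rmult_lt_reg_r (8 * INR N)); [lra|].
        replace ((2 * INR N + 3) / (8 * INR N) * (8 * INR N))
          with (2 * INR N + 3) by (field; lra). lra. }
  destruct (pigeonhole_unhit N
    (fun i p => exists t, piece i t /\ crit t /\ J p (g t))) as (p & Hp & Hmiss).
  { intros i p p' (t & Pt & Ct & Jt) (t' & Pt' & Ct' & Jt').
    assert (Hsmall := diam i t t' Pt Pt' Ct Ct'). apply Rabs_def2 in Hsmall.
    unfold J in Jt, Jt'.
    destruct (lt_eq_lt_dec p p') as [[H|H]|H]; auto; exfalso;
      apply le_INR in H; rewrite S_INR in H; nra. }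
  apply le_INR in Hp.
  generalize (pos_INR p); intros Hp0.
  exists (u + (2 * INR p + 1) * w), (u + (2 * INR p + 2) * w).
  repeat split; try nra.
  intros z Hz (t & Ht & Dt & ->).
  (* [i] is the index of a piece containing [t]; the strict bound [t < c + l] makes it less than
     [N]. *)
  destruct (nfloor_ex ((t - c) / (l / INR N))) as [i Hi].
  { apply Rmult_le_pos; [lra | left; apply Rinv_0_lt_compat; lra]. }
  assert (Et : (t - c) / (l / INR N) * (l / INR N) = t - c) by (field; lra).
  assert (El : INR N * (l / INR N) = l) by (field; lra).
  apply (Hmiss i).
  - apply INR_lt. apply (Rmult_lt_reg_r (l / INR N)); [lra|]. nra.
  - exists t. repeat split; auto; try lra; nra.
Qed.

(** * Lipschitz bounds across a curve *)

Lemma difference_quotient_sign (h : R -> R) (t l : R) :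
  is_derive h t l -> l <> 0 ->
  exists d, 0 < d /\
    forall s, s <> 0 -> Rabs s < d -> 0 < (h (t + s) - h t) / s * l.
Proof.
  intros Hh Hl. apply is_derive_Reals in Hh.
  destruct (Hh (Rabs l) (Rabs_pos_lt l Hl)) as [d Hd].
  exists d. split; [apply cond_pos|].
  intros s Hs0 Hs. specialize (Hd s Hs0 Hs). apply Rabs_def2 in Hd.
  unfold Rabs in Hd. destruct (Rcase_abs l); nra.
Qed.

Lemma continuous_eps (h : R -> R) (t eps : R) :
  continuous h t -> 0 < eps ->
  exists d, 0 < d /\ forall s, Rabs (s - t) < d -> Rabs (h s - h t) < eps.
Proof.
  intros Hh He.
  destruct (proj1 (filterlim_locally _ _) Hh (mkposreal eps He)) as [d Hd].
  exists d. split; [apply cond_pos | exact Hd].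
Qed.

(* Zygmund's lemma.  Pick a value [z] strictly between [h a] and [h b] and not
   taken on [Z]; the derivative at the last time [h] is at most [z] cannot be
   negative. *)
Lemma nonincreasing_off_null_image (h : R -> R) (a b : R) (Z : R -> Prop) :
  a <= b ->
  (forall t, a <= t <= b -> continuous h t) ->
  (forall t, a <= t <= b -> ~ Z t -> exists l, l < 0 /\ is_derive h t l) ->
  (forall u v, u < v -> exists z, u < z < v /\ forall t, Z t -> h t <> z) ->
  h b <= h a.
Proof.
  intros Hab Hc Hd HZ. apply Rnot_lt_le. intros Hlt.
  destruct (HZ _ _ Hlt) as (z & Hz & HzZ).
  set (E := fun t => a <= t <= b /\ h t <= z).
  destruct (completeness E) as [t0 [Hub Hlub]].
  { exists b. intros t [Ht _]. lra. }
  { exists a. split; lra. }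
  assert (Ht0 : a <= t0 <= b).
  { split; [apply Hub; split; lra | apply Hlub; intros t [Ht _]; lra]. }
  assert (right : forall d, 0 < d -> t0 < b -> exists s, 0 < s < d /\ z < h (t0 + s)).
  { intros d Hd0 Hb. exists (Rmin (d / 2) (b - t0)).
    assert (H1 := Rmin_l (d / 2) (b - t0)). assert (H2 := Rmin_r (d / 2) (b - t0)).
    assert (H3 : 0 < Rmin (d / 2) (b - t0)) by (apply Rmin_glb_lt; lra).
    split; [lra|]. apply Rnot_le_lt. intros Hle.
    assert (H4 : t0 + Rmin (d / 2) (b - t0) <= t0) by (apply Hub; split; lra).
    lra. }
  (* If [h t0] is below [z], continuity contradicts [right]. If it is above, continuity yields a
     smaller upper bound of [E]. If it equals [z], the negative derivative contradicts the larger
     values just to the right of [t0]. *)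
  destruct (Rtotal_order (h t0) z) as [H | [H | H]].
  - destruct (continuous_eps h t0 (z - h t0) (Hc t0 Ht0)) as (d & Hd0 & Hd1); [lra|].
    assert (t0 < b).
    { destruct (proj2 Ht0) as [?|E0]; [assumption | rewrite E0 in H; lra]. }
    destruct (right d Hd0 H0) as (s & Hs & Hs').
    assert (Hds := Hd1 (t0 + s)). replace (t0 + s - t0) with s in Hds by ring.
    rewrite (Rabs_pos_eq s) in Hds by lra. specialize (Hds (proj2 Hs)).
    apply Rabs_def2 in Hds. lra.
  - assert (t0 < b).
    { destruct (proj2 Ht0) as [?|E0]; [assumption | rewrite E0 in H; lra]. }
    destruct (Hd t0 Ht0) as (l & Hl & Hder).
    { intros Zt. exact (HzZ t0 Zt H). }
    destruct (difference_quotient_sign h t0 l Hder) as (d & Hd0 & Hd1); [lra|].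
    destruct (right d Hd0 H0) as (s & Hs & Hs').
    assert (Hq : 0 < (h (t0 + s) - h t0) / s * l).
    { apply Hd1; [lra | rewrite Rabs_pos_eq; lra]. }
    assert (0 < (h (t0 + s) - h t0) / s) by (apply Rdiv_lt_0_compat; lra).
    nra.
  - destruct (continuous_eps h t0 (h t0 - z) (Hc t0 Ht0)) as (d & Hd0 & Hd1); [lra|].
    assert (Hle : t0 <= t0 - d); [|lra].
    apply Hlub. intros t [Ht Hht].
    apply Rnot_lt_le. intros Htd.
    assert (t <= t0) by (apply Hub; split; assumption).
    assert (Rabs (h t - h t0) < h t0 - z) by (apply Hd1, Rabs_def1; lra).
    apply Rabs_def2 in H1. lra.
Qed.

Lemma open_interval_margin (a b : Rbar) (s : R) :
  Rbar_lt a s -> Rbar_lt s b ->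
  exists d, 0 < d /\ forall t, Rabs (t - s) <= d -> Rbar_lt a t /\ Rbar_lt t b.
Proof.
  intros Ha Hb.
  destruct (filter_and _ _ (open_Rbar_gt' s a Ha) (open_Rbar_lt' s b Hb)) as [d Hd].
  assert (Hd0 := cond_pos d).
  exists (d / 2). split; [lra|]. intros t Ht. apply Hd.
  change (Rabs (t - s) < d). lra.
Qed.

(** [critical_values_nowhere_dense] handles compact parameter segments; the countable cover makes it
    global, as the parameter interval is open and possibly unbounded. *)
Lemma regular_value_dense (a b : Rbar) (g : R -> R) :
  (forall s : R, Rbar_lt a s -> Rbar_lt s b -> ex_derive g s /\ continuous (Derive g) s) ->
  forall u v, u < v -> exists c, u < c < v /\
    forall s : R, Rbar_lt a s -> Rbar_lt s b -> g s = c -> Derive g s <> 0.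
Proof.
  intros Hg u v Huv.
  destruct (avoid_locally_nowhere_dense_image
    (fun s => Rbar_lt a s /\ Rbar_lt s b /\ Derive g s = 0) g) with (2 := Huv)
    as (c & Hc & Hn).
  - intros s (Ha & Hb & _).
    destruct (open_interval_margin a b s Ha Hb) as (d & Hd & Hin).
    exists d. split; [exact Hd|].
    apply nowhere_dense_subset with
      (fun z => exists t, s - d <= t < s - d + 2 * d /\ Derive g t = 0 /\ z = g t).
    + intros z (t & (_ & _ & Dt) & Ht & Ez). exists t.
      apply Rabs_def2 in Ht. repeat split; auto; lra.
    + apply critical_values_nowhere_dense; [lra|].
      intros t Ht. destruct (Hin t); [apply Rabs_le; lra|]. apply Hg; assumption.
  - exists c. split; [exact Hc|]. intros s Ha Hb E D0. apply (Hn s); auto.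
Qed.

Lemma continuity_2d_pt_section (f : R -> R -> R) (x y : R) :
  continuity_2d_pt f x y -> continuous (fun t => f t y) x.
Proof.
  intros H. apply filterlim_locally. intros eps.
  destruct (H eps) as [d Hd]. exists d. intros t Ht.
  apply (Hd t y); [exact Ht | rewrite Rminus_eq_0, Rabs_R0; apply cond_pos].
Qed.

(* On a horizontal line [y = c] with [c] a regular value of the second coordinate,
   the curve is crossed at isolated parameters only, so
   [nonincreasing_off_null_image] applies.  Such [c] are dense. *)
Lemma row_increment_le (a b : Rbar) (x y : R -> R) (f : R -> R -> R)
    (x1 x2 y1 y2 M : R) :
  (forall s : R, Rbar_lt a s -> Rbar_lt s b -> ex_derive y s /\ continuous (Derive y) s) ->
  (forall u c, continuity_2d_pt f u c) ->
  (forall u c, x1 < u < x2 -> y1 < c < y2 ->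
     ~ (exists s : R, Rbar_lt a s /\ Rbar_lt s b /\ u = x s /\ c = y s) ->
     ex_derive (fun t => f t c) u /\ Derive (fun t => f t c) u <= M) ->
  forall u v c, x1 < u -> u <= v -> v < x2 -> y1 < c < y2 ->
  f v c - f u c <= M * (v - u).
Proof.
  intros Hy Hf HM u v c Hu Huv Hv Hc.
  apply le_epsilon. intros eps Heps.
  (* Three errors of size at most [e] will occur: moving the values at [u] and at [v] to a nearby
     regular row [c'], and enlarging [M]. *)
  set (e := eps / 4).
  assert (He : 0 < e) by (unfold e; lra).
  destruct (Hf v c (mkposreal e He)) as [d1 Hd1].
  destruct (Hf u c (mkposreal e He)) as [d2 Hd2].
  simpl in Hd1, Hd2.
  assert (Hd1' := cond_pos d1). assert (Hd2' := cond_pos d2).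
  set (d := Rmin (Rmin d1 d2) (y2 - c)).
  assert (Hd0 : 0 < d) by (unfold d; repeat apply Rmin_glb_lt; lra).
  assert (Hdd1 : d <= d1) by (unfold d; eapply Rle_trans; apply Rmin_l).
  assert (Hdd2 : d <= d2)
    by (unfold d; eapply Rle_trans; [apply Rmin_l | apply Rmin_r]).
  assert (Hdy : d <= y2 - c) by (unfold d; apply Rmin_r).
  destruct (regular_value_dense a b y Hy c (c + d)) as (c' & Hc' & Hreg); [lra|].
  (* The excess over [M] makes the derivative of [f t c' - M' * t] strictly negative off the curve;
     the added 1 keeps the denominator positive when [u = v]. *)
  set (M' := M + e / (v - u + 1)).
  assert (Hq : 0 < e / (v - u + 1)) by (apply Rdiv_lt_0_compat; lra).
  assert (Hmain : f v c' - M' * v <= f u c' - M' * u).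
  { apply (nonincreasing_off_null_image (fun t => f t c' - M' * t) u v
      (fun t => exists s : R, Rbar_lt a s /\ Rbar_lt s b /\ t = x s /\ c' = y s) Huv).
    - intros t _. apply (continuous_minus (fun t => f t c') (fun t => M' * t)).
      + apply continuity_2d_pt_section, Hf.
      + apply (ex_derive_continuous (fun t => M' * t)). auto_derive. exact I.
    - intros t Ht HZ. destruct (HM t c') as [H1 H2]; [lra | lra | exact HZ |].
      exists (Derive (fun t => f t c') t - M'). split; [unfold M'; lra|].
      apply (is_derive_minus (fun t => f t c') (fun t => M' * t)).
      + apply Derive_correct, H1.
      + auto_derive; [exact I | ring].
    (* The values to avoid are those taken where the curve meets the row. Such a parameter is
       isolated, since [y] has a non-zero derivative there, so locally a single value occurs. *)
    - intros p q Hpq.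
      destruct (avoid_locally_nowhere_dense_image
        (fun s => Rbar_lt a s /\ Rbar_lt s b /\ y s = c')
        (fun s => f (x s) c' - M' * x s)) with (2 := Hpq) as (z & Hz & Hn).
      + intros s (Ha & Hb & Es).
        destruct (difference_quotient_sign y s (Derive y s)) as (r & Hr & Hiso).
        { apply Derive_correct, Hy; assumption. }
        { apply Hreg; assumption. }
        assert (Hone : forall t, y t = c' -> Rabs (t - s) < r -> t = s).
        { intros t Et Ht. apply NNPP. intros Hne.
          assert (Hts := Hiso (t - s)).
          replace (s + (t - s)) with t in Hts by ring.
          rewrite Et, Es in Hts. replace (c' - c') with 0 in Hts by ring.
          unfold Rdiv in Hts. rewrite !Rmult_0_l in Hts.
          apply (Rlt_irrefl 0), Hts; [lra | exact Ht]. }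
        exists r. split; [exact Hr|]. apply nowhere_dense_subsingleton.
        intros z1 z2 (t1 & (_ & _ & E1) & H1 & ->) (t2 & (_ & _ & E2) & H2 & ->).
        rewrite (Hone t1 E1 H1), (Hone t2 E2 H2). reflexivity.
      + exists z. split; [exact Hz|].
        intros t (s & Ha & Hb & -> & Ec). apply Hn. auto. }
  assert (H1 : Rabs (f v c' - f v c) < e).
  { apply Hd1; [rewrite Rminus_eq_0, Rabs_R0; lra | apply Rabs_def1; lra]. }
  assert (H2 : Rabs (f u c' - f u c) < e).
  { apply Hd2; [rewrite Rminus_eq_0, Rabs_R0; lra | apply Rabs_def1; lra]. }
  apply Rabs_def2 in H1. apply Rabs_def2 in H2.
  assert (H3 : e / (v - u + 1) * (v - u) <= e).
  { assert (Em : e / (v - u + 1) * (v - u + 1) = e) by (field; lra). nra. }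
  unfold M' in Hmain. unfold e in *. nra.
Qed.

(** [row_increment_le] for [f] and for [- f] bounds the increment from both sides. *)
Lemma row_lipschitz (a b : Rbar) (x y : R -> R) (f : R -> R -> R)
    (x1 x2 y1 y2 M : R) :
  (forall s : R, Rbar_lt a s -> Rbar_lt s b -> ex_derive y s /\ continuous (Derive y) s) ->
  (forall u c, continuity_2d_pt f u c) ->
  (forall u c, x1 < u < x2 -> y1 < c < y2 ->
     ~ (exists s : R, Rbar_lt a s /\ Rbar_lt s b /\ u = x s /\ c = y s) ->
     ex_derive (fun t => f t c) u /\ Rabs (Derive (fun t => f t c) u) <= M) ->
  forall u v c, x1 < u < x2 -> x1 < v < x2 -> y1 < c < y2 ->
  Rabs (f v c - f u c) <= M * Rabs (v - u).
Proof.
  intros Hy Hf HM.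
  assert (ordered : forall u v c, x1 < u -> u <= v -> v < x2 -> y1 < c < y2 ->
    Rabs (f v c - f u c) <= M * (v - u)).
  { intros u v c Hu Huv Hv Hc. apply Rabs_le. split.
    - assert (- f v c - - f u c <= M * (v - u)); [|lra].
      apply (row_increment_le a b x y (fun t c => - f t c) x1 x2 y1 y2 M Hy);
        try assumption.
      + intros p q. apply continuity_2d_pt_opp, Hf.
      + intros p q Hp Hq Hn. destruct (HM p q Hp Hq Hn) as [H1 H2]. split.
        * apply (ex_derive_opp (fun t => f t q)), H1.
        * rewrite Derive_opp. apply Rabs_le_between in H2. lra.
    - apply (row_increment_le a b x y f x1 x2 y1 y2 M Hy); try assumption.
      intros p q Hp Hq Hn. destruct (HM p q Hp Hq Hn) as [H1 H2]. split; [exact H1|].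
      apply Rabs_le_between in H2. lra. }
  intros u v c Hu Hv Hc. destruct (Rle_lt_dec u v) as [H | H].
  - rewrite (Rabs_pos_eq (v - u)) by lra. apply ordered; lra.
  - rewrite Rabs_minus_sym, (Rabs_minus_sym v u), (Rabs_pos_eq (u - v)) by lra.
    apply ordered; lra.
Qed.

(** * Local bounds near a point of the curve *)

Lemma uniform_radius_bound (Q : nat -> R -> R -> Prop) (N : nat) :
  (forall n d M d' M', Q n d M -> 0 < d' <= d -> M <= M' -> Q n d' M') ->
  (forall n, (n <= N)%nat -> exists d M, 0 < d /\ Q n d M) ->
  exists d M, 0 < d /\ forall n, (n <= N)%nat -> Q n d M.
Proof.
  intros Hmon. induction N as [|N IH]; intros H.
  - destruct (H O (le_n 0)) as (d & M & Hd & HQ). exists d, M. split; [exact Hd|].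
    intros n Hn. replace n with O by lia. exact HQ.
  - destruct IH as (d & M & Hd & HQ); [intros n Hn; apply H; lia|].
    destruct (H (S N) (le_n _)) as (d' & M' & Hd' & HQ').
    exists (Rmin d d'), (Rmax M M'). split; [apply Rmin_glb_lt; assumption|].
    assert (Hmin : 0 < Rmin d d') by (apply Rmin_glb_lt; assumption).
    intros n Hn. destruct (Nat.eq_dec n (S N)) as [-> | Hne].
    + apply Hmon with (1 := HQ'); [split; [exact Hmin | apply Rmin_r] | apply Rmax_r].
    + apply (Hmon n d M); [apply HQ; lia | split; [exact Hmin | apply Rmin_l] | apply Rmax_l].
Qed.

Lemma square_in_disc (xi p : R * R) (delta : R) :
  0 < delta -> Rabs (fst p - fst xi) < delta / 2 -> Rabs (snd p - snd xi) < delta / 2 ->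
  disc xi delta p.
Proof.
  intros Hd H1 H2. unfold disc.
  apply Rabs_def2 in H1. apply Rabs_def2 in H2. nra.
Qed.

(** The continuous extension has a limit at [xi], hence is bounded near [xi]. *)
Lemma extension_bounded_near (m : nat) (f : R -> R -> R) (B E : R * R -> Prop)
    (xi : R * R) (a1 a2 : nat) :
  derivatives_extend m f B E -> E xi -> (a1 + a2 <= m)%nat ->
  exists d M, 0 < d /\
    forall x y, Rabs (x - fst xi) < d -> Rabs (y - snd xi) < d -> B (x, y) ->
    Rabs (partial_derive a1 a2 f x y) <= M.
Proof.
  intros Hext HE Ha. destruct (Hext a1 a2 Ha) as (g & Hg & Hlim).
  destruct (proj1 (filterlim_locally _ _) (Hlim xi (or_intror HE)) (mkposreal 1 Rlt_0_1))
    as [d Hd].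
  exists d, (Rabs (g xi) + 1). split; [apply cond_pos|].
  intros x y Hx Hy HB.
  assert (H : Rabs (g (x, y) - g xi) < 1).
  { apply Hd; [split; assumption | left; exact HB]. }
  rewrite (Hg _ HB) in H. simpl in H.
  assert (T := Rabs_triang_inv (partial_derive a1 a2 f x y) (g xi)). lra.
Qed.

(** A point off the curve and close to [xi] lies in one of the two parts, where the extension up to
    [xi] supplies the bound. The condition [4 <= m] covers all pairs of indices up to 2. *)
Lemma regular_outside_bounds (m : nat) (Gamma : R * R -> Prop) (f : R -> R -> R)
    (xi : R * R) :
  (4 <= m)%nat -> regular_outside m Gamma f -> Gamma xi ->
  exists rho M, 0 < rho /\
    forall x y, Rabs (x - fst xi) < rho -> Rabs (y - snd xi) < rho -> ~ Gamma (x, y) ->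
    ex_diff_n f m x y /\
    forall a1 a2, (a1 <= 2)%nat -> (a2 <= 2)%nat -> Rabs (partial_derive a1 a2 f x y) <= M.
Proof.
  intros Hm [Hreg Hside] Hxi.
  destruct (Hside xi Hxi) as (delta & Bm & Bp & Hd & Hdiv & Hextm & Hextp).
  destruct Hdiv as (Om & Op & _ & _ & _ & _ & _ & Hcov).
  assert (HE : Gamma xi /\ disc xi delta xi).
  { split; [exact Hxi|]. unfold disc. nra. }
  set (Q := fun a1 a2 d M => forall x y,
    Rabs (x - fst xi) < d -> Rabs (y - snd xi) < d -> Bm (x, y) \/ Bp (x, y) ->
    Rabs (partial_derive a1 a2 f x y) <= M).
  assert (HQ : exists d M, 0 < d /\ forall a1, (a1 <= 2)%nat ->
    forall a2, (a2 <= 2)%nat -> Q a1 a2 d M).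
  { assert (mon : forall a1 a2 d M d' M', Q a1 a2 d M -> 0 < d' <= d -> M <= M' ->
      Q a1 a2 d' M').
    { intros a1 a2 d M d' M' H Hd' HM x y Hx Hy HB.
      apply Rle_trans with M; [apply H|]; try assumption; lra. }
    apply (uniform_radius_bound
      (fun a1 d M => forall a2, (a2 <= 2)%nat -> Q a1 a2 d M)).
    { intros a1 d M d' M' H Hd' HM a2 Ha2. apply (mon a1 a2 d M); auto. }
    intros a1 Ha1. apply (uniform_radius_bound (Q a1)).
    { apply mon. }
    intros a2 Ha2.
    destruct (extension_bounded_near m f Bm _ xi a1 a2 Hextm HE) as (d1 & M1 & Hd1 & H1); [lia|].
    destruct (extension_bounded_near m f Bp _ xi a1 a2 Hextp HE) as (d2 & M2 & Hd2 & H2); [lia|].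
    exists (Rmin d1 d2), (Rmax M1 M2). split; [apply Rmin_glb_lt; assumption|].
    intros x y Hx Hy HB.
    assert (L1 := Rmin_l d1 d2). assert (L2 := Rmin_r d1 d2).
    destruct HB as [HB | HB].
    - apply Rle_trans with (2 := Rmax_l M1 M2). apply H1; [lra | lra | exact HB].
    - apply Rle_trans with (2 := Rmax_r M1 M2). apply H2; [lra | lra | exact HB]. }
  destruct HQ as (d & M & Hd0 & HQ).
  exists (Rmin d (delta / 2)), M. split; [apply Rmin_glb_lt; lra|].
  intros x y Hx Hy HG.
  assert (L1 := Rmin_l d (delta / 2)). assert (L2 := Rmin_r d (delta / 2)).
  assert (HB : Bm (x, y) \/ Bp (x, y)).
  { apply Hcov. split; [apply square_in_disc; simpl; lra | exact HG]. }
  split.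
  - apply (Hreg (x, y)).
    (* [class_C] asks for a whole neighbourhood free of the curve; the openness of both parts
       provides it. *)
    assert (HO : locally (x, y) (fun p => Bm p \/ Bp p)).
    { apply (open_or Bm Bp Om Op), HB. }
    revert HO. apply filter_imp. intros p Hp. apply Hcov, Hp.
  - intros a1 a2 Ha1 Ha2. apply HQ; auto; lra.
Qed.

(** Move horizontally to the column of [xi], then vertically along it. Both legs may meet the curve
    and are treated by [row_lipschitz], the second after exchanging the coordinates. *)
Lemma lipschitz_near (Gamma : R * R -> Prop) (f : R -> R -> R) (xi : R * R) (rho M : R) :
  C1_curve Gamma ->
  (forall x y, continuity_2d_pt f x y) ->
  (forall x y, Rabs (x - fst xi) < rho -> Rabs (y - snd xi) < rho -> ~ Gamma (x, y) ->
     ex_diff_n f 1 x y /\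
     Rabs (partial_derive 1 0 f x y) <= M /\ Rabs (partial_derive 0 1 f x y) <= M) ->
  forall x y, Rabs (x - fst xi) < rho -> Rabs (y - snd xi) < rho ->
  Rabs (f x y - f (fst xi) (snd xi)) <= M * Rabs (x - fst xi) + M * Rabs (y - snd xi).
Proof.
  intros (a & b & X & Y & _ & HXY & HG) Hf HM x y Hx Hy.
  destruct xi as [x0 y0]. simpl in *.
  assert (Hrho : 0 < rho) by (generalize (Rabs_pos (x - x0)); lra).
  assert (Hoff : forall u c,
    ~ (exists s : R, Rbar_lt a s /\ Rbar_lt s b /\ u = X s /\ c = Y s) -> ~ Gamma (u, c)).
  { intros u c Hn HGp. apply Hn. apply HG in HGp. destruct HGp as (s & ? & ? & E).
    injection E as -> ->. exists s. auto. }
  assert (Hrow : Rabs (f x y - f x0 y) <= M * Rabs (x - x0)).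
  { apply Rabs_def2 in Hx. apply Rabs_def2 in Hy.
    apply (row_lipschitz a b X Y f (x0 - rho) (x0 + rho) (y0 - rho) (y0 + rho));
      try assumption; try lra.
    - intros s Ha Hb. destruct (HXY s Ha Hb) as (? & ? & ? & ? & ?). auto.
    - intros u c Hu Hc Hn.
      destruct (HM u c) as ((_ & ? & _) & ? & _); auto;
        apply Rabs_def1; lra. }
  assert (Hcol : Rabs (f x0 y - f x0 y0) <= M * Rabs (y - y0)).
  { apply Rabs_def2 in Hx. apply Rabs_def2 in Hy.
    apply (row_lipschitz a b Y X (fun u v => f v u) (y0 - rho) (y0 + rho) (x0 - rho) (x0 + rho));
      try assumption; try lra.
    - intros s Ha Hb. destruct (HXY s Ha Hb) as (? & ? & ? & ? & ?). auto.
    - intros u c eps. destruct (Hf c u eps) as [d Hd]. exists d.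
      intros u' c' Hu' Hc'. exact (Hd c' u' Hc' Hu').
    - intros u c Hu Hc Hn.
      destruct (HM c u) as ((_ & _ & ? & _) & _ & ?); try (apply Rabs_def1; lra).
      + apply Hoff. intros (s & ? & ? & ? & ?). apply Hn. exists s. auto.
      + auto. }
  replace (f x y - f x0 y0) with ((f x y - f x0 y) + (f x0 y - f x0 y0)) by ring.
  apply Rle_trans with (1 := Rabs_triang _ _). lra.
Qed.

(* First-order Taylor expansion along the path going vertically, then horizontally,
   which only involves the mixed derivative [partial_derive 1 1]. *)
Lemma affine_taylor_bound (f : R -> R -> R) (x0 y0 h M : R) :
  (forall x y, x0 <= x <= x0 + h -> y0 <= y <= y0 + h ->
     ex_diff_n f 2 x y /\
     forall a1 a2, (a1 + a2 = 2)%nat -> Rabs (partial_derive a1 a2 f x y) <= M) ->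
  forall x y, x0 <= x <= x0 + h -> y0 <= y <= y0 + h ->
  Rabs (f x y - (f x0 y0 + partial_derive 1 0 f x0 y0 * (x - x0)
                 + partial_derive 0 1 f x0 y0 * (y - y0))) <= 3 * M * h ^ 2.
Proof.
  intros Hf x y Hx Hy.
  assert (mean : forall (g : R -> R) p q, p <= q ->
    (forall t, p <= t <= q -> ex_derive g t /\ Rabs (Derive g t) <= M) ->
    Rabs (g q - g p) <= M * (q - p)).
  { intros g p q Hpq Hg. destruct (MVT_gen g p q (Derive g)) as (c & Hc & E).
    - intros t Ht. rewrite Rmin_left, Rmax_right in Ht by exact Hpq.
      apply Derive_correct, Hg; lra.
    - intros t Ht. rewrite Rmin_left, Rmax_right in Ht by exact Hpq.
      apply continuity_pt_filterlim, (ex_derive_continuous g), Hg; lra.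
    - rewrite Rmin_left, Rmax_right in Hc by exact Hpq.
      rewrite E, Rabs_mult, (Rabs_pos_eq (q - p)) by lra.
      apply Rmult_le_compat_r; [lra | apply Hg, Hc]. }
  (* Two uses of the mean value theorem suffice, with constant [M] instead of [M / 2]. *)
  assert (taylor1 : forall (g : R -> R) p q, p <= q ->
    (forall t, p <= t <= q -> ex_derive g t /\ ex_derive (Derive g) t /\
       Rabs (Derive (Derive g) t) <= M) ->
    Rabs (g q - g p - Derive g p * (q - p)) <= M * (q - p) ^ 2).
  { intros g p q Hpq Hg. destruct (MVT_gen g p q (Derive g)) as (c & Hc & E).
    - intros t Ht. rewrite Rmin_left, Rmax_right in Ht by exact Hpq.
      apply Derive_correct, Hg; lra.
    - intros t Ht. rewrite Rmin_left, Rmax_right in Ht by exact Hpq.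
      apply continuity_pt_filterlim, (ex_derive_continuous g), Hg; lra.
    - rewrite Rmin_left, Rmax_right in Hc by exact Hpq.
      replace (g q - g p - Derive g p * (q - p))
        with ((Derive g c - Derive g p) * (q - p)) by (rewrite E; ring).
      assert (H := mean (Derive g) p c (proj1 Hc)).
      assert (HM : 0 <= M).
      { eapply Rle_trans; [apply Rabs_pos | apply (Hg p); lra]. }
      rewrite Rabs_mult, (Rabs_pos_eq (q - p)) by lra.
      assert (Rabs (Derive g c - Derive g p) <= M * (c - p)).
      { apply H. intros t Ht. destruct (Hg t) as (_ & ? & ?); [lra | auto]. }
      apply Rle_trans with (M * (c - p) * (q - p));
        [apply Rmult_le_compat_r; lra |].
      assert (M * (c - p) <= M * (q - p)) by (apply Rmult_le_compat_l; lra). nra. }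
  assert (H1 : Rabs (f x y - f x y0 - partial_derive 0 1 f x y0 * (y - y0))
    <= M * (y - y0) ^ 2).
  { apply (taylor1 (fun v => f x v)); [lra|]. intros t Ht.
    destruct (Hf x t) as [(_ & _ & ? & _ & (_ & _ & ? & _)) HM]; [lra | lra |].
    split; [assumption | split; [assumption|]].
    apply (HM 0%nat 2%nat). reflexivity. }
  assert (H2 : Rabs (partial_derive 0 1 f x y0 - partial_derive 0 1 f x0 y0)
    <= M * (x - x0)).
  { apply (mean (fun u => partial_derive 0 1 f u y0)); [lra|]. intros t Ht.
    destruct (Hf t y0) as [(_ & _ & _ & _ & (_ & ? & _ & _)) HM]; [lra | lra |].
    split; [assumption|]. apply (HM 1%nat 1%nat). reflexivity. }
  assert (H3 : Rabs (f x y0 - f x0 y0 - partial_derive 1 0 f x0 y0 * (x - x0))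
    <= M * (x - x0) ^ 2).
  { apply (taylor1 (fun u => f u y0)); [lra|]. intros t Ht.
    destruct (Hf t y0) as [(_ & ? & _ & (_ & ? & _ & _) & _) HM]; [lra | lra |].
    split; [assumption | split; [assumption|]].
    apply (HM 2%nat 0%nat). reflexivity. }
  (* Vertical remainder at abscissa [x], change of the vertical slope between [x0] and [x],
     horizontal remainder at height [y0]: each is at most [M * h ^ 2]. *)
  replace (f x y - (f x0 y0 + partial_derive 1 0 f x0 y0 * (x - x0)
                 + partial_derive 0 1 f x0 y0 * (y - y0)))
    with ((f x y - f x y0 - partial_derive 0 1 f x y0 * (y - y0))
      + (partial_derive 0 1 f x y0 - partial_derive 0 1 f x0 y0) * (y - y0)
      + (f x y0 - f x0 y0 - partial_derive 1 0 f x0 y0 * (x - x0))) by ring.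
  assert (H4 : Rabs ((partial_derive 0 1 f x y0 - partial_derive 0 1 f x0 y0) * (y - y0))
    <= M * (x - x0) * (y - y0)).
  { rewrite Rabs_mult, (Rabs_pos_eq (y - y0)) by lra. apply Rmult_le_compat_r; lra. }
  assert (HM : 0 <= M).
  { destruct (Hf x0 y0) as [_ HM]; [lra | lra |].
    eapply Rle_trans; [apply Rabs_pos | apply (HM 2%nat 0%nat); reflexivity]. }
  apply Rle_trans with (M * (y - y0) ^ 2 + M * (x - x0) * (y - y0) + M * (x - x0) ^ 2).
  { eapply Rle_trans; [apply Rabs_triang|]. apply Rplus_le_compat; [|exact H3].
    eapply Rle_trans; [apply Rabs_triang|]. apply Rplus_le_compat; assumption. }
  replace (M * (y - y0) ^ 2 + M * (x - x0) * (y - y0) + M * (x - x0) ^ 2)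
    with (M * ((y - y0) ^ 2 + (x - x0) * (y - y0) + (x - x0) ^ 2)) by ring.
  replace (3 * M * h ^ 2) with (M * (3 * h ^ 2)) by ring.
  apply Rmult_le_compat_l; [exact HM|]. nra.
Qed.

(** * Polynomials and Lagrange interpolation *)

(** Polynomial functions of degree at most [n]. Peeling off the top monomial turns the closure
    properties into inductions on the degree. *)
Fixpoint poly_le (n : nat) (p : R -> R) : Prop :=
  match n with
  | O => exists c, forall x, p x = c
  | S n' => exists q c, poly_le n' q /\ forall x, p x = q x + c * x ^ S n'
  end.

Lemma poly_le_ext (n : nat) (p q : R -> R) :
  (forall x, p x = q x) -> poly_le n q -> poly_le n p.
Proof.
  intros E. destruct n as [|n]; simpl.
  - intros [c H]. exists c. intros x. rewrite E. apply H.
  - intros (s & c & H & H'). exists s, c. split; [exact H|]. intros x. rewrite E. apply H'.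
Qed.

Lemma poly_le_sum_n (n : nat) (c : nat -> R) :
  poly_le n (fun x => sum_n (fun a => c a * x ^ a) n).
Proof.
  induction n as [|n IH].
  - exists (c O). intros x. rewrite sum_O. simpl. ring.
  - eexists _, (c (S n)). split; [exact IH|]. intros x. rewrite sum_Sn. reflexivity.
Qed.

Lemma poly_le_S (n : nat) (p : R -> R) : poly_le n p -> poly_le (S n) p.
Proof.
  intros H. exists p, 0. split; [exact H|]. intros x. ring.
Qed.

Lemma poly_le_weaken (n m : nat) (p : R -> R) : (n <= m)%nat -> poly_le n p -> poly_le m p.
Proof.
  intros H Hp. induction H; [exact Hp | apply poly_le_S; assumption].
Qed.

Lemma poly_le_lin (n : nat) (p q : R -> R) (a b : R) :
  poly_le n p -> poly_le n q -> poly_le n (fun x => a * p x + b * q x).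
Proof.
  revert p q. induction n as [|n IH]; intros p q; simpl.
  - intros [c Hc] [d Hd]. exists (a * c + b * d). intros x. rewrite Hc, Hd. reflexivity.
  - intros (p' & c & Hp' & Hp) (q' & d & Hq' & Hq).
    eexists _, (a * c + b * d). split; [apply (IH p' q' Hp' Hq')|].
    intros x. rewrite Hp, Hq. ring.
Qed.

Lemma poly_le_scal (n : nat) (p : R -> R) (a : R) :
  poly_le n p -> poly_le n (fun x => a * p x).
Proof.
  intros H. apply (poly_le_ext _ _ (fun x => a * p x + 0 * p x)).
  - intros x. ring.
  - apply poly_le_lin; exact H.
Qed.

Lemma poly_le_sum (n N : nat) (p : nat -> R -> R) :
  (forall l, poly_le n (p l)) -> poly_le n (fun x => sum_n (fun l => p l x) N).
Proof.
  intros H. induction N as [|N IH].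
  - apply poly_le_ext with (2 := H O). intros x. apply sum_O.
  - apply (poly_le_ext _ _ (fun x => 1 * sum_n (fun l => p l x) N + 1 * p (S N) x)).
    + intros x. rewrite sum_Sn. unfold plus. simpl. ring.
    + apply poly_le_lin; [exact IH | apply H].
Qed.

Lemma poly_le_mulX (n : nat) (p : R -> R) :
  poly_le n p -> poly_le (S n) (fun x => x * p x).
Proof.
  revert p. induction n as [|n IH]; intros p.
  - intros [c Hc]. exists (fun _ => 0), c. split; [exists 0; reflexivity|].
    intros x. rewrite Hc. ring.
  - intros (q & c & Hq & Hp). exists (fun x => x * q x), c. split; [exact (IH q Hq)|].
    intros x. rewrite Hp. simpl. ring.
Qed.

Lemma poly_le_affine_pow (n : nat) (a b : R) : poly_le n (fun x => (a + b * x) ^ n).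
Proof.
  induction n as [|n IH].
  - exists 1. reflexivity.
  - apply (poly_le_ext _ _ (fun x => a * (a + b * x) ^ n + b * (x * (a + b * x) ^ n))).
    + intros x. simpl. ring.
    + apply (poly_le_lin (S n) (fun x => (a + b * x) ^ n)).
      * apply poly_le_S, IH.
      * apply (poly_le_mulX n), IH.
Qed.

Lemma poly_le_affine_comp (n : nat) (p : R -> R) (a b : R) :
  poly_le n p -> poly_le n (fun x => p (a + b * x)).
Proof.
  revert p. induction n as [|n IH]; intros p.
  - intros [c Hc]. exists c. intros x. apply Hc.
  - intros (q & c & Hq & Hp).
    apply (poly_le_ext _ _ (fun x => 1 * q (a + b * x) + c * (a + b * x) ^ S n)).
    + intros x. rewrite Hp. ring.
    + apply (poly_le_lin (S n) (fun x => q (a + b * x))).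
      * apply poly_le_S, IH, Hq.
      * apply poly_le_affine_pow.
Qed.

(** The degree bound is kept rather than lowered, so that [poly_le_derive_n] iterates at constant
    [n]. *)
Lemma poly_le_derive (n : nat) (p : R -> R) :
  poly_le n p -> (forall x, ex_derive p x) /\ poly_le n (Derive p).
Proof.
  revert p. induction n as [|n IH]; intros p.
  - intros [c Hc]. split.
    + intros x. apply ex_derive_ext with (fun _ => c); [intros t; symmetry; apply Hc|].
      apply ex_derive_const.
    + exists 0. intros x. rewrite (Derive_ext _ _ x Hc). apply Derive_const.
  - intros (q & c & Hq & Hp). destruct (IH q Hq) as [H1 H2].
    assert (Hd : forall x, is_derive p x (Derive q x + c * (INR (S n) * x ^ n))).
    { intros x. apply is_derive_ext with (fun t => q t + c * t ^ S n).
      { intros t. symmetry. apply Hp. }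
      apply (is_derive_plus q (fun t => c * t ^ S n)).
      - apply Derive_correct, H1.
      - auto_derive; [exact I|]. simpl. ring. }
    split.
    + intros x. eexists. apply Hd.
    + apply (poly_le_ext _ _ (fun x => 1 * Derive q x + (c * INR (S n)) * x ^ n)).
      * intros x. rewrite (is_derive_unique _ _ _ (Hd x)). ring.
      * apply (poly_le_lin (S n) (Derive q)); [apply poly_le_S, H2|].
        apply poly_le_S. apply (poly_le_ext _ _ (fun x => (0 + 1 * x) ^ n)).
        -- intros x. f_equal. ring.
        -- apply poly_le_affine_pow.
Qed.

Lemma poly_le_derive_n (n k : nat) (p : R -> R) :
  poly_le n p -> poly_le n (Derive_n p k).
Proof.
  intros H. induction k as [|k IH]; [exact H | apply poly_le_derive, IH].
Qed.

Lemma poly_le_ex_derive_n (n k : nat) (p : R -> R) (x : R) :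
  poly_le n p -> ex_derive_n p k x.
Proof.
  intros H. destruct k as [|k]; [exact I|].
  apply (poly_le_derive n), poly_le_derive_n, H.
Qed.

Lemma poly_le_continuous (n : nat) (p : R -> R) (x : R) : poly_le n p -> continuous p x.
Proof.
  intros H. apply (ex_derive_continuous p), (poly_le_derive n p H).
Qed.

Lemma poly_le_bounded (n : nat) (p : R -> R) (b : R) :
  poly_le n p -> exists K, forall x, 0 <= x <= b -> Rabs (p x) <= K.
Proof.
  revert p. induction n as [|n IH]; intros p.
  - intros [c Hc]. exists (Rabs c). intros x _. rewrite Hc. apply Rle_refl.
  - intros (q & c & Hq & Hp). destruct (IH q Hq) as [K HK].
    exists (K + Rabs c * b ^ S n). intros x Hx. rewrite Hp.
    eapply Rle_trans; [apply Rabs_triang|].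
    apply Rplus_le_compat; [apply HK, Hx|].
    rewrite Rabs_mult. apply Rmult_le_compat_l; [apply Rabs_pos|].
    rewrite Rabs_pos_eq by (apply pow_le; lra). apply pow_incr, Hx.
Qed.

Lemma Derive_n_linear_comb (n N k : nat) (u : nat -> R) (p : nat -> R -> R) (x : R) :
  (forall l, poly_le n (p l)) ->
  Derive_n (fun t => sum_n (fun l => u l * p l t) N) k x
  = sum_n (fun l => u l * Derive_n (p l) k x) N.
Proof.
  intros H. rewrite (Derive_n_sum_n N (fun l t => u l * p l t) k x).
  - apply sum_n_ext. intros l. apply Derive_n_scal_l.
  - apply filter_forall. intros t l i _ _.
    apply ex_derive_n_scal_l, (poly_le_ex_derive_n n), H.
Qed.

Lemma Derive_n_affine_comp (n k : nat) (p : R -> R) (a d x : R) :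
  d <> 0 -> poly_le n p ->
  Derive_n (fun t => p ((t - a) / d)) k x = Derive_n p k ((x - a) / d) / d ^ k.
Proof.
  intros Hd Hp. revert x. induction k as [|k IH]; intros x.
  - simpl. field.
  - simpl Derive_n at 1. rewrite (Derive_ext _ _ x IH).
    apply is_derive_unique.
    assert (Hk := proj1 (poly_le_derive n _ (poly_le_derive_n n k p Hp)) ((x - a) / d)).
    apply Derive_correct in Hk.
    apply (is_derive_ext (fun t => scal (/ d ^ k) (Derive_n p k ((t - a) / d)))).
    { intros t. unfold scal. simpl. unfold mult. simpl. unfold Rdiv. ring. }
    replace (Derive_n p (S k) ((x - a) / d) / d ^ S k)
      with (scal (/ d ^ k) (scal (/ d) (Derive (Derive_n p k) ((x - a) / d)))).
    + apply (is_derive_scal (fun t => Derive_n p k ((t - a) / d))).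
      apply (is_derive_comp (Derive_n p k) (fun t => (t - a) / d)); [exact Hk|].
      auto_derive; [exact I | field; exact Hd].
    + unfold scal. simpl. unfold mult. simpl. field. split; [apply pow_nonzero|]; exact Hd.
Qed.

Lemma Derive_n_affine_eq0 (a b x : R) (k : nat) :
  (2 <= k)%nat -> Derive_n (fun t => a + b * t) k x = 0.
Proof.
  intros Hk. destruct k as [|[|k]]; try lia.
  replace (S (S k)) with (k + 2)%nat by lia. rewrite <- Derive_n_comp.
  assert (E : forall t, Derive_n (fun t => a + b * t) 2 t = 0).
  { intros t. simpl. rewrite (Derive_ext _ (fun _ => b)); [apply Derive_const|].
    intros s. apply is_derive_unique. auto_derive; [exact I | ring]. }
  rewrite (Derive_n_ext _ _ k x E). destruct k as [|k]; [reflexivity|].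
  apply Derive_n_const.
Qed.

Lemma partial_derive_affine_eq0 (c0 c1 c2 x y : R) (a1 a2 : nat) :
  (2 <= a1 + a2)%nat ->
  partial_derive a1 a2 (fun t z => c0 + c1 * t + c2 * z) x y = 0.
Proof.
  intros H. unfold partial_derive. destruct a2 as [|[|a2]].
  - rewrite (Derive_n_ext _ (fun t => (c0 + c2 * y) + c1 * t)).
    + apply Derive_n_affine_eq0. lia.
    + intros t. simpl. ring.
  - rewrite (Derive_n_ext _ (fun t => c2)).
    + destruct a1 as [|a1]; [lia | apply Derive_n_const].
    + intros t. apply is_derive_unique. auto_derive; [exact I | ring].
  - rewrite (Derive_n_ext _ (fun t => 0)).
    + destruct a1 as [|a1]; [reflexivity | apply Derive_n_const].
    + intros t. apply Derive_n_affine_eq0. lia.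
Qed.

(** Newton's polynomial for the nodes [0, ..., n - 1], that is, the falling factorial. *)
Fixpoint node_poly (n : nat) (x : R) : R :=
  match n with O => 1 | S n' => (x - INR n') * node_poly n' x end.

Lemma node_poly_monic (n : nat) :
  exists q, poly_le n q /\ forall x, node_poly (S n) x = q x + x ^ S n.
Proof.
  induction n as [|n [q [Hq E]]].
  - exists (fun _ => 0). split; [exists 0; reflexivity|]. intros x. simpl. ring.
  - exists (fun x => 1 * (x * q x) + (- INR (S n)) * (q x + x ^ S n)). split.
    + apply (poly_le_lin (S n) (fun x => x * q x) (fun x => q x + x ^ S n)).
      * apply poly_le_mulX, Hq.
      * exists q, 1. split; [exact Hq|]. intros x. ring.
    + intros x.
      change (node_poly (S (S n)) x) with ((x - INR (S n)) * node_poly (S n) x).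
      rewrite E. change (x ^ S (S n)) with (x * x ^ S n). ring.
Qed.

Lemma node_poly_node (n l : nat) : (l < n)%nat -> node_poly n (INR l) = 0.
Proof.
  induction n as [|n IH]; [lia|]. intros H. simpl.
  destruct (Nat.eq_dec l n) as [-> | Hne].
  - ring.
  - rewrite IH by lia. ring.
Qed.

Lemma node_poly_neq0 (n l : nat) : (n <= l)%nat -> node_poly n (INR l) <> 0.
Proof.
  induction n as [|n IH]; intros H; simpl; [lra|].
  apply Rmult_integral_contrapositive_currified; [|apply IH; lia].
  assert (INR n < INR l) by (apply lt_INR; lia). lra.
Qed.

Lemma sum_n_affine (f g : nat -> R) (k : R) (N : nat) :
  sum_n (fun l => f l + g l * k) N = sum_n f N + sum_n g N * k.
Proof.
  induction N as [|N IH].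
  - rewrite !sum_O. reflexivity.
  - rewrite !sum_Sn, IH. unfold plus. simpl. ring.
Qed.

(* Newton's construction: subtracting a multiple of [node_poly] lowers the degree
   without changing the values at the previous nodes. *)
Lemma lagrange_basis (r : nat) :
  exists L : nat -> R -> R, (forall l, poly_le r (L l)) /\
    forall p, poly_le r p -> forall s, p s = sum_n (fun l => p (INR l) * L l s) r.
Proof.
  induction r as [|r (L & HL & E)].
  - exists (fun _ _ => 1). split; [intros _; exists 1; reflexivity|].
    intros p [c Hc] s. rewrite sum_O, !Hc. ring.
  - set (W := node_poly (S r)). set (w := W (INR (S r))).
    assert (Hw : w <> 0) by (apply node_poly_neq0; lia).
    destruct (node_poly_monic r) as (W0 & HW0 & EW).
    assert (HW : poly_le (S r) W).
    { exists W0, 1. split; [exact HW0|]. intros x. unfold W. rewrite EW. ring. }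
    (* The old basis functions are corrected by a multiple of [W] so as to vanish at the new node;
       the new one is [W] normalised to 1 there. *)
    exists (fun l s => if (l <=? r)%nat then 1 * L l s + (- (L l (INR (S r)) / w)) * W s
                       else (/ w) * W s).
    split.
    + intros l. destruct (l <=? r)%nat.
      * apply poly_le_lin; [apply poly_le_S, HL | exact HW].
      * apply poly_le_scal, HW.
    + intros p (q & c & Hq & Hp) s.
      (* [g] is [p - c * W]: the leading terms cancel because [W] is monic, so the induction
         hypothesis applies to it. *)
      set (g := fun x => 1 * q x + (- c) * W0 x).
      assert (Hg : poly_le r g) by (apply poly_le_lin; assumption).
      assert (Epg : forall x, p x = g x + c * W x).
      { intros x. unfold g, W. rewrite Hp, EW. ring. }
      assert (Enode : forall l, (l <= r)%nat -> p (INR l) = g (INR l)).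
      { intros l Hl. rewrite Epg. unfold W. rewrite node_poly_node by lia. ring. }
      assert (Eg : forall x, g x = sum_n (fun l => p (INR l) * L l x) r).
      { intros x. rewrite (E g Hg x). apply sum_n_ext_loc. intros l Hl.
        rewrite Enode by exact Hl. reflexivity. }
      rewrite sum_Sn.
      rewrite (sum_n_ext_loc _ (fun l => p (INR l) * L l s
        + p (INR l) * L l (INR (S r)) * (- (W s / w))) r).
      2:{ intros l Hl. rewrite (proj2 (Nat.leb_le l r)) by exact Hl.
          match goal with |- @eq _ ?a ?b => change (@eq R a b) end. field. exact Hw. }
      rewrite sum_n_affine, <- (Eg s), <- (Eg (INR (S r))).
      rewrite (proj2 (Nat.leb_gt (S r) r)) by lia.
      unfold plus. simpl plus.
      rewrite (Epg s), (Epg (INR (S r))). fold w. simpl. field. exact Hw.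
Qed.

(** * Iterated integrals of sums of products *)

(** The inner integral of [u x * v y] is [u x] times a constant, so the existence of iterated
    integrals reduces to one-variable continuity. The constructor [separable_ext] stands in for
    functional extensionality. *)
Inductive separable : (R -> R -> R) -> Prop :=
  | separable_prod (u v : R -> R) :
      (forall x, continuous u x) -> (forall y, continuous v y) ->
      separable (fun x y => u x * v y)
  | separable_plus (F G : R -> R -> R) :
      separable F -> separable G -> separable (fun x y => F x y + G x y)
  | separable_ext (F G : R -> R -> R) :
      (forall x y, F x y = G x y) -> separable F -> separable G.

Lemma separable_mult (F G : R -> R -> R) :
  separable F -> separable G -> separable (fun x y => F x y * G x y).
Proof.
  intros HF. revert G. induction HF as [u v Hu Hv | F1 F2 _ IH1 _ IH2 | F1 F2 E _ IH];
    intros G HG.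
  - induction HG as [u' v' Hu' Hv' | G1 G2 _ IH1 _ IH2 | G1 G2 E _ IH].
    + apply separable_ext with (fun x y => (u x * u' x) * (v y * v' y)).
      { intros x y. ring. }
      apply (separable_prod (fun x => u x * u' x) (fun y => v y * v' y)).
      * intros x. apply (continuous_mult u u'); auto.
      * intros x. apply (continuous_mult v v'); auto.
    + apply separable_ext with (fun x y => u x * v y * G1 x y + u x * v y * G2 x y).
      { intros x y. ring. }
      apply separable_plus; assumption.
    + apply separable_ext with (2 := IH). intros x y. rewrite E. reflexivity.
  - apply separable_ext with (fun x y => F1 x y * G x y + F2 x y * G x y).
    { intros x y. ring. }
    apply separable_plus; auto.
  - apply separable_ext with (2 := IH G HG). intros x y. rewrite E. reflexivity.
Qed.

Lemma separable_sum_n (F : nat -> R -> R -> R) (N : nat) :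
  (forall l, separable (F l)) -> separable (fun x y => sum_n (fun l => F l x y) N).
Proof.
  intros H. induction N as [|N IH].
  - apply separable_ext with (2 := H O). intros x y. rewrite sum_O. reflexivity.
  - apply separable_ext with (2 := separable_plus _ _ IH (H (S N))).
    intros x y. rewrite sum_Sn. reflexivity.
Qed.

Lemma separable_integral_continuous (F : R -> R -> R) (c d : R) :
  separable F ->
  (forall x y, continuous (F x) y) /\
  (forall x, continuous (fun x => RInt (F x) c d) x).
Proof.
  intros HF. induction HF as [u v Hu Hv | F G _ [IF1 IF2] _ [IG1 IG2] | F G E _ [I1 I2]].
  - split.
    + intros x y. apply (continuous_mult (fun _ => u x) v); [apply continuous_const | auto].
    + intros x. apply continuous_ext with (fun x => u x * RInt v c d).
      * intros t. symmetry. apply (RInt_scal v c d (u t)).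
        apply (ex_RInt_continuous v). auto.
      * apply (continuous_mult u (fun _ => RInt v c d)); [auto | apply continuous_const].
  - split.
    + intros x y. apply (continuous_plus (F x) (G x)); auto.
    + intros x. apply continuous_ext with (fun x => RInt (F x) c d + RInt (G x) c d).
      * intros t. symmetry. apply (RInt_plus (F t) (G t) c d).
        -- apply (ex_RInt_continuous (F t)). auto.
        -- apply (ex_RInt_continuous (G t)). auto.
      * apply (continuous_plus (fun x => RInt (F x) c d) (fun x => RInt (G x) c d)); auto.
  - split.
    + intros x y. apply continuous_ext with (F x); auto.
    + intros x. apply continuous_ext with (fun x => RInt (F x) c d); [|auto].
      intros t. apply RInt_ext. auto.
Qed.

Lemma separable_double_integral_bound (F : R -> R -> R) (a b c d M : R) :
  separable F -> a <= b -> c <= d ->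
  (forall x y, a <= x <= b -> c <= y <= d -> Rabs (F x y) <= M) ->
  Rabs (RInt (fun x => RInt (fun y => F x y) c d) a b) <= (b - a) * ((d - c) * M).
Proof.
  intros HF Hab Hcd HM.
  destruct (separable_integral_continuous F c d HF) as [H1 H2].
  apply abs_RInt_le_const; [exact Hab | |].
  - apply (ex_RInt_continuous (fun x => RInt (fun y => F x y) c d)).
    intros x _. apply H2.
  - intros x Hx. apply abs_RInt_le_const; [exact Hcd | |].
    + apply (ex_RInt_continuous (F x)). auto.
    + intros y Hy. apply HM; assumption.
Qed.

Lemma sum_n_Rabs_le (u : nat -> R) (N : nat) (M : R) :
  (forall l, (l <= N)%nat -> Rabs (u l) <= M) -> Rabs (sum_n u N) <= (INR N + 1) * M.
Proof.
  induction N as [|N IH]; intros H.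
  - rewrite sum_O. simpl. rewrite Rplus_0_l, Rmult_1_l. apply H. lia.
  - rewrite sum_Sn. eapply Rle_trans; [apply Rabs_triang|].
    rewrite S_INR. assert (H1 := H (S N) (le_n _)).
    assert (H2 : Rabs (sum_n u N) <= (INR N + 1) * M) by (apply IH; intros; apply H; lia).
    lra.
Qed.

(** * Rescaled interpolants and the bound on [beta] *)

Lemma in_Q_poly_le (r : nat) (P : R -> R -> R) :
  in_Q r P -> (forall y, poly_le r (fun x => P x y)) /\ (forall x, poly_le r (P x)).
Proof.
  intros [c Hc]. split.
  - intros y. apply poly_le_ext with (2 := poly_le_sum_n r
      (fun a => sum_n (fun b => c a b * y ^ b) r)).
    intros x. rewrite Hc. apply sum_n_ext. intros a.
    rewrite <- (sum_n_mult_r (K := R_Ring) (x ^ a)).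
    apply sum_n_ext. intros b. unfold mult. simpl.
    match goal with |- @eq _ ?u ?v => change (@eq R u v) end. ring.
  - intros x. apply poly_le_ext with
      (fun y => sum_n (fun a => sum_n (fun b => (c a b * x ^ a) * y ^ b) r) r).
    + intros y. apply Hc.
    + apply poly_le_sum. intros a. apply (poly_le_sum_n r (fun b => c a b * x ^ a)).
Qed.

Lemma affine_add_partial_derive (r : nat) (S : R -> R -> R) (c0 c1 c2 x y : R) (a1 a2 : nat) :
  (forall t, poly_le r (S t)) ->
  poly_le r (fun t => Derive_n (S t) a2 y) ->
  (2 <= a1 + a2)%nat ->
  partial_derive a1 a2 (fun t z => c0 + c1 * t + c2 * z + S t z) x y
  = partial_derive a1 a2 S x y.
Proof.
  intros HS HS' Ha.
  assert (Haff : forall a b : R, poly_le 1 (fun z => a + b * z)).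
  { intros a b. exists (fun _ => a), b. split; [exists a; reflexivity|].
    intros z. ring. }
  transitivity (partial_derive a1 a2 (fun t z => c0 + c1 * t + c2 * z) x y
    + partial_derive a1 a2 S x y).
  2:{ rewrite partial_derive_affine_eq0 by exact Ha. ring. }
  unfold partial_derive.
  rewrite (Derive_n_ext _ (fun t => Derive_n (fun z => c0 + c1 * t + c2 * z) a2 y
    + Derive_n (S t) a2 y)).
  2:{ intros t. apply (Derive_n_plus (fun z => c0 + c1 * t + c2 * z) (S t));
      apply filter_forall; intros z k _.
      - apply (poly_le_ex_derive_n 1), Haff.
      - apply (poly_le_ex_derive_n r), HS. }
  apply (Derive_n_plus (fun t => Derive_n (fun z => c0 + c1 * t + c2 * z) a2 y)
    (fun t => Derive_n (S t) a2 y)); apply filter_forall; intros t k _.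
  - apply (poly_le_ex_derive_n 1). destruct a2 as [|[|a2]].
    + apply poly_le_ext with (2 := Haff (c0 + c2 * y) c1). intros s. simpl. ring.
    + apply poly_le_ext with (2 := Haff c2 0). intros s.
      apply is_derive_unique. auto_derive; [exact I | ring].
    + apply poly_le_ext with (2 := Haff 0 0). intros s.
      rewrite Derive_n_affine_eq0 by lia. ring.
  - apply (poly_le_ex_derive_n r), HS'.
Qed.

Lemma tensor_partial_derive (r N : nat) (V : nat -> nat -> R) (A B : nat -> R -> R)
    (x y : R) (a1 a2 : nat) :
  (forall l, poly_le r (A l)) -> (forall l, poly_le r (B l)) ->
  partial_derive a1 a2
    (fun t z => sum_n (fun n => sum_n (fun l => V l n * A l t) N * B n z) N) x y
  = sum_n (fun n => sum_n (fun l => V l n * Derive_n (A l) a1 x) N * Derive_n (B n) a2 y) N.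
Proof.
  intros HA HB. unfold partial_derive.
  rewrite (Derive_n_ext _ (fun t => sum_n (fun n => Derive_n (B n) a2 y
    * sum_n (fun l => V l n * A l t) N) N)).
  2:{ intros t.
      rewrite (Derive_n_linear_comb r N a2 (fun n => sum_n (fun l => V l n * A l t) N) B y HB).
      apply sum_n_ext. intros n. apply Rmult_comm. }
  rewrite (Derive_n_linear_comb r N a1 (fun n => Derive_n (B n) a2 y)
    (fun n t => sum_n (fun l => V l n * A l t) N)).
  - apply sum_n_ext. intros n. rewrite (Derive_n_linear_comb r N a1 (fun l => V l n) A x HA).
    apply Rmult_comm.
  - intros n. apply poly_le_sum. intros l. apply poly_le_scal, HA.
Qed.

(** One-variable reproduction in [y] at fixed [x], then in [x] along each row of nodes. *)
Lemma lagrange_expansion (r : nat) (L : nat -> R -> R) (S : R -> R -> R) (X Y d x y : R) :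
  (forall p, poly_le r p -> forall s, p s = sum_n (fun l => p (INR l) * L l s) r) ->
  (forall y, poly_le r (fun x => S x y)) -> (forall x, poly_le r (S x)) -> d <> 0 ->
  S x y = sum_n (fun n => sum_n (fun l => S (X + d * INR l) (Y + d * INR n)
    * L l ((x - X) / d)) r * L n ((y - Y) / d)) r.
Proof.
  intros HL Hx Hy Hd.
  assert (E1 := HL (fun t => S x (Y + d * t)) (poly_le_affine_comp r (S x) Y d (Hy x))
    ((y - Y) / d)).
  cbv beta in E1. replace (Y + d * ((y - Y) / d)) with y in E1 by (field; exact Hd).
  rewrite E1. apply sum_n_ext. intros n. f_equal.
  assert (E2 := HL (fun t => S (X + d * t) (Y + d * INR n))
    (poly_le_affine_comp r (fun t => S t (Y + d * INR n)) X d (Hx _)) ((x - X) / d)).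
  cbv beta in E2. replace (X + d * ((x - X) / d)) with x in E2 by (field; exact Hd).
  exact E2.
Qed.

(** The factor [(d ^ a) ^ 2] cancels the scaling of a squared derivative of order [a]; each variable
    leaves [1 / d ^ 2], also when [a = 0]. *)
Lemma powerRZ_weight (d : R) (a : nat) :
  d <> 0 -> powerRZ d (2 * (Z.of_nat a - 1)) = (d ^ a) ^ 2 / d ^ 2.
Proof.
  intros Hd. replace (2 * (Z.of_nat a - 1))%Z with (Z.of_nat (a * 2) + (- 2))%Z by lia.
  rewrite powerRZ_add by exact Hd. rewrite <- pow_powerRZ, pow_mult. reflexivity.
Qed.

(* In the rescaled coordinates [(x - X) / d], each weighted integral is [d ^ (-2)]
   times an integral over a unit cell.  Derivatives of order at least two do not see
   the affine part, so they are controlled by the deviation [eps] at the nodes. *)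
Lemma beta_bound (r : nat) :
  (1 <= r)%nat ->
  exists K, 0 <= K /\
  forall (d : R) (j i : Z) (k w : nat) (P : R -> R -> R) (c0 c1 c2 eps : R),
    0 < d -> 0 <= eps -> (k <= r - 1)%nat -> (w <= r - 1)%nat -> in_Q r P ->
    (forall p, stencil r d j i k w p ->
       Rabs (P (fst p) (snd p) - (c0 + c1 * fst p + c2 * snd p)) <= eps) ->
    Rabs (beta r d j i P) <= K * eps ^ 2 / d ^ 2.
Proof.
  intros Hr. destruct (lagrange_basis r) as (L & HL & HLE).
  assert (HK : exists K, 0 <= K /\ forall a l s, (a <= r)%nat -> (l <= r)%nat ->
    0 <= s <= INR r -> Rabs (Derive_n (L l) a s) <= K).
  (* The radius in [uniform_radius_bound] is a dummy here: the point is a common bound for finitely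
     many functions. *)
  { set (Q := fun a l (_ M : R) => forall s, 0 <= s <= INR r -> Rabs (Derive_n (L l) a s) <= M).
    assert (mon : forall a l e M e' M', Q a l e M -> 0 < e' <= e -> M <= M' -> Q a l e' M').
    { intros a l e M e' M' H _ HM s Hs. apply Rle_trans with M; auto. }
    destruct (uniform_radius_bound (fun a e M => forall l, (l <= r)%nat -> Q a l e M) r)
      as (e & K & _ & HK).
    - intros a e M e' M' H He HM l Hl. apply (mon a l e M); auto.
    - intros a Ha. apply (uniform_radius_bound (Q a)); [apply mon|].
      intros l Hl.
      destruct (poly_le_bounded r _ (INR r) (poly_le_derive_n r a (L l) (HL l))) as [K HK].
      exists 1, K. split; [lra | exact HK].
    - exists K. split.
      + eapply Rle_trans; [apply Rabs_pos|]. apply (HK O); [lia | apply (Nat.le_0_l r) |].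
        split; [apply Rle_refl | apply pos_INR].
      + intros a l s Ha Hl Hs. apply (HK a Ha l Hl s Hs). }
  destruct HK as (K & HK0 & HK).
  set (c := INR r + 1).
  assert (Hc : 0 < c) by (unfold c; generalize (pos_INR r); lra).
  (* The two outer factors [c] come from the sums over the orders, the two inner ones from the sums
     over the nodes, and [K * K] from one basis derivative in each variable. *)
  exists (c * (c * (c * (c * (K * K))) ^ 2)). split.
  { repeat (apply Rmult_le_pos; [lra|]). apply pow2_ge_0. }
  intros d j i k w P c0 c1 c2 eps Hd Heps Hk Hw HP Hnode.
  destruct (in_Q_poly_le r P HP) as [HPx HPy].
  set (X := grid d (j + Z.of_nat k - Z.of_nat r)).
  set (Y := grid d (i + Z.of_nat w - Z.of_nat r)).
  set (T := fun x y => c0 + c1 * x + c2 * y).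
  set (S := fun x y => P x y - T x y).
  assert (Haff : forall a b : R, poly_le r (fun z => a + b * z)).
  { intros a b. apply (poly_le_weaken 1); [exact Hr|].
    exists (fun _ => a), b. split; [exists a; reflexivity|]. intros z. ring. }
  assert (HSx : forall y, poly_le r (fun x => S x y)).
  { intros y. apply (poly_le_ext _ _
      (fun x => 1 * P x y + (-1) * ((c0 + c2 * y) + c1 * x))).
    - intros x. unfold S, T. ring.
    - apply (poly_le_lin r (fun x => P x y)); auto. }
  assert (HSy : forall x, poly_le r (S x)).
  { intros x. apply (poly_le_ext _ _
      (fun y => 1 * P x y + (-1) * ((c0 + c1 * x) + c2 * y))).
    - intros y. unfold S, T. ring.
    - apply (poly_le_lin r (P x)); auto. }
  set (V := fun l n => S (X + d * INR l) (Y + d * INR n)).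
  assert (HV : forall l n, (l <= r)%nat -> (n <= r)%nat -> Rabs (V l n) <= eps).
  { intros l n Hl Hn.
    apply (Hnode (X + d * INR l, Y + d * INR n)).
    exists (j + Z.of_nat k - Z.of_nat r + Z.of_nat l)%Z,
           (i + Z.of_nat w - Z.of_nat r + Z.of_nat n)%Z.
    split; [lia | split; [lia|]].
    unfold X, Y, grid. rewrite !plus_IZR, !INR_IZR_INZ. f_equal; ring. }
  set (A := fun l x => L l ((x - X) / d)).
  set (B := fun n y => L n ((y - Y) / d)).
  assert (Hscale : forall p Z0, poly_le r p -> poly_le r (fun x => p ((x - Z0) / d))).
  { intros p Z0 Hp. apply (poly_le_ext _ _ (fun x => p (- Z0 / d + / d * x))).
    - intros x. f_equal. field. lra.
    - apply poly_le_affine_comp, Hp. }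
  assert (HA : forall l, poly_le r (A l)) by (intros l; apply Hscale, HL).
  assert (HB : forall l, poly_le r (B l)) by (intros l; apply Hscale, HL).
  assert (HPd : forall a1 a2 x y, (2 <= a1 + a2)%nat -> partial_derive a1 a2 P x y =
    sum_n (fun n => sum_n (fun l => V l n * Derive_n (A l) a1 x) r * Derive_n (B n) a2 y) r).
  { intros a1 a2 x y Ha.
    rewrite <- (tensor_partial_derive r r V A B x y a1 a2 HA HB).
    set (U := fun t z => sum_n (fun n => sum_n (fun l => V l n * A l t) r * B n z) r).
    rewrite <- (affine_add_partial_derive r U c0 c1 c2 x y a1 a2).
    - unfold partial_derive. apply Derive_n_ext. intros t. apply Derive_n_ext. intros z.
      transitivity (T t z + S t z); [unfold S; ring|]. unfold T. f_equal.
      apply lagrange_expansion; auto. lra.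
    - intros t. apply poly_le_sum. intros n. apply poly_le_scal, HB.
    - apply (poly_le_ext _ _ (fun t => sum_n (fun n => Derive_n (B n) a2 y
        * sum_n (fun l => V l n * A l t) r) r)).
      + intros t. unfold U.
        rewrite (Derive_n_linear_comb r r a2 (fun n => sum_n (fun l => V l n * A l t) r) B y HB).
        apply sum_n_ext. intros n. apply Rmult_comm.
      + apply poly_le_sum. intros n. apply poly_le_scal, poly_le_sum. intros l.
        apply poly_le_scal, HA.
    - exact Ha. }
  assert (Hsum : forall u M, (forall l, (l <= r)%nat -> Rabs (u l) <= M) ->
    Rabs (sum_n u r) <= c * M).
  { intros u M Hu. apply sum_n_Rabs_le, Hu. }
  (* The integration cell lies in the hull of the stencil: its left end has rescaled coordinate
     [r - e - 1], non-negative because [e <= r - 1]. *)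
  assert (Hcell : forall (b q : Z) (e : nat) z, (e <= r - 1)%nat ->
    q = (b + Z.of_nat e - Z.of_nat r)%Z -> grid d (b - 1) <= z <= grid d b ->
    0 <= (z - grid d q) / d <= INR r).
  { intros b q e z He -> Hz. unfold grid in *.
    rewrite !minus_IZR, !plus_IZR in *. rewrite <- !INR_IZR_INZ.
    assert (He1 : INR e + 1 <= INR r) by (rewrite <- S_INR; apply le_INR; lia).
    assert (He0 := pos_INR e).
    assert (Ez : (z - (IZR b + INR e - INR r) * d) / d * d
      = z - (IZR b + INR e - INR r) * d) by (field; lra).
    split; apply (Rmult_le_reg_r d); try exact Hd; rewrite Ez; nra. }
  assert (Hder : forall (l a : nat) (Z0 x : R), (l <= r)%nat -> (a <= r)%nat ->
    0 <= (x - Z0) / d <= INR r ->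
    Rabs (Derive_n (fun t => L l ((t - Z0) / d)) a x) <= K / d ^ a).
  { intros l a Z0 x Hl Ha Hx. rewrite (Derive_n_affine_comp r) by (auto; lra).
    assert (0 < d ^ a) by (apply pow_lt; exact Hd).
    unfold Rdiv. rewrite Rabs_mult, (Rabs_pos_eq (/ d ^ a)).
    - apply Rmult_le_compat_r; [left; apply Rinv_0_lt_compat; assumption | auto].
    - left. apply Rinv_0_lt_compat; assumption. }
  unfold beta.
  set (M := (c * (c * (K * K))) ^ 2 * eps ^ 2 / d ^ 2).
  assert (HM : 0 <= M).
  { unfold M. apply Rmult_le_pos.
    - apply Rmult_le_pos; apply pow2_ge_0.
    - left. apply Rinv_0_lt_compat, pow_lt, Hd. }
  replace (c * (c * (c * (c * (K * K))) ^ 2) * eps ^ 2 / d ^ 2) with (c * (c * M))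
    by (unfold M; field; lra).
  apply Hsum. intros a1 Ha1.
  apply Hsum. intros a2 Ha2.
  destruct (2 <=? a1 + a2)%nat eqn:Ha; [apply Nat.leb_le in Ha | rewrite Rabs_R0; exact HM].
  assert (Hd1 : 0 < d ^ a1) by (apply pow_lt; exact Hd).
  assert (Hd2 : 0 < d ^ a2) by (apply pow_lt; exact Hd).
  (* Pointwise bound of the weighted squared derivative: the weights leave [1 / d ^ 4], and the cell
     area [d ^ 2] turns it into [M]. *)
  set (N := (c * (c * (K * K))) ^ 2 * eps ^ 2 / d ^ 4).
  replace M with ((grid d j - grid d (j - 1)) * ((grid d i - grid d (i - 1)) * N)).
  2:{ unfold M, N, grid. rewrite !minus_IZR. field. lra. }
  assert (Hgrid : forall b, grid d (b - 1) <= grid d b).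
  { intros b. unfold grid. rewrite minus_IZR. nra. }
  apply (separable_double_integral_bound (fun x y => powerRZ d (2 * (Z.of_nat a1 - 1))
    * powerRZ d (2 * (Z.of_nat a2 - 1)) * partial_derive a1 a2 P x y ^ 2)); auto.
  - assert (HsepP : separable (partial_derive a1 a2 P)).
    { apply separable_ext with (fun x y => sum_n (fun n =>
        sum_n (fun l => V l n * Derive_n (A l) a1 x) r * Derive_n (B n) a2 y) r).
      { intros x y. symmetry. apply HPd, Ha. }
      apply separable_sum_n. intros n.
      apply (separable_prod (fun x => sum_n (fun l => V l n * Derive_n (A l) a1 x) r)
        (Derive_n (B n) a2)).
      - intros x. apply (poly_le_continuous r). apply poly_le_sum. intros l.
        apply poly_le_scal, poly_le_derive_n, HA.
      - intros y. apply (poly_le_continuous r), poly_le_derive_n, HB. }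
    set (W := powerRZ d (2 * (Z.of_nat a1 - 1)) * powerRZ d (2 * (Z.of_nat a2 - 1))).
    apply separable_ext with (fun x y => W * 1
      * (partial_derive a1 a2 P x y * partial_derive a1 a2 P x y)).
    { intros x y. ring. }
    apply (separable_mult (fun _ _ => W * 1)).
    + apply (separable_prod (fun _ => W) (fun _ => 1)); intros; apply continuous_const.
    + apply separable_mult; exact HsepP.
  - intros x y Hx Hy.
    rewrite !powerRZ_weight by lra.
    assert (HD : Rabs (partial_derive a1 a2 P x y)
      <= c * (c * (eps * (K / d ^ a1)) * (K / d ^ a2))).
    { rewrite HPd by exact Ha. apply Hsum.
      intros n Hn. rewrite Rabs_mult. apply Rmult_le_compat; try apply Rabs_pos.
      - apply Hsum. intros l Hl. rewrite Rabs_mult.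
        apply Rmult_le_compat; try apply Rabs_pos; auto.
        apply Hder; auto. apply (Hcell j _ k); auto.
      - apply Hder; auto. apply (Hcell i _ w); auto. }
    assert (Hweight : 0 <= (d ^ a1) ^ 2 / d ^ 2 * ((d ^ a2) ^ 2 / d ^ 2)).
    { apply Rmult_le_pos; apply Rle_mult_inv_pos;
        first [apply pow2_ge_0 | apply pow_lt, Hd]. }
    rewrite Rabs_mult, <- RPow_abs, (Rabs_pos_eq _ Hweight).
    replace N with ((d ^ a1) ^ 2 / d ^ 2 * ((d ^ a2) ^ 2 / d ^ 2)
      * (c * (c * (eps * (K / d ^ a1)) * (K / d ^ a2))) ^ 2)
      by (unfold N; field; lra).
    apply Rmult_le_compat_l; [exact Hweight|].
    apply pow_incr. split; [apply Rabs_pos | exact HD].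
Qed.

(** * The two asymptotic estimates *)

Lemma disc_coordinates (xi p : R * R) (delta : R) :
  0 < delta -> disc xi delta p ->
  Rabs (fst p - fst xi) < delta /\ Rabs (snd p - snd xi) < delta.
Proof.
  unfold disc. intros Hd H.
  assert (H1 := pow2_ge_0 (fst p - fst xi)). assert (H2 := pow2_ge_0 (snd p - snd xi)).
  split; (apply Rnot_le_lt; intros Hn;
    assert (H3 := pow_incr _ _ 2 (conj (Rlt_le _ _ Hd) Hn));
    rewrite pow2_abs in H3; lra).
Qed.

Theorem proposition2p2 (r m : nat) (Gamma : R * R -> Prop) (f : R -> R -> R)
    (xi : R * R) (C : R)
    (hr : (1 < r)%nat) (hm : (2 * r + 1 <= m)%nat)
    (hGamma : C1_curve Gamma)
    (hcont : forall x y : R, continuity_2d_pt f x y)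
    (hreg : regular_outside m Gamma f)
    (hsing : singularity_curve Gamma f)
    (hxi : Gamma xi) (hC : 0 < C)
    (hsecond : exists Delta0 : R, 0 < Delta0 /\
       forall Delta : R, 0 < Delta < Delta0 ->
       forall p : R * R, disc xi (C * Delta) p -> ~ Gamma p ->
       exists a1 a2 : nat, (a1 + a2 = 2)%nat /\
         partial_derive a1 a2 f (fst p) (snd p) <> 0)
    (k w : nat) (hk : (k <= r - 1)%nat) (hw : (w <= r - 1)%nat) :
  (exists K Delta0 : R, 0 < Delta0 /\
     forall Delta : R, 0 < Delta < Delta0 ->
     forall j i : Z,
     (forall k' w' : nat, (k' <= r - 1)%nat -> (w' <= r - 1)%nat ->
        forall p, stencil r Delta j i k' w' p -> disc xi (C * Delta) p) ->
     forall P : R -> R -> R,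
     interpolates r f (stencil r Delta j i k w) P ->
     ~ (exists p, Gamma p /\ stencil_hull r Delta j i k w p) ->
     Rabs (beta r Delta j i P) <= K * Delta ^ 2)
  /\
  (exists K Delta0 : R, 0 < Delta0 /\
     forall Delta : R, 0 < Delta < Delta0 ->
     forall j i : Z,
     (forall k' w' : nat, (k' <= r - 1)%nat -> (w' <= r - 1)%nat ->
        forall p, stencil r Delta j i k' w' p -> disc xi (C * Delta) p) ->
     forall P : R -> R -> R,
     interpolates r f (stencil r Delta j i k w) P ->
     (exists p, Gamma p /\ stencil_hull r Delta j i k w p) ->
     Rabs (beta r Delta j i P) <= K).
Proof.
  destruct (beta_bound r) as (K & HK0 & HK); [lia|].
  destruct (regular_outside_bounds m Gamma f xi) as (rho & M0 & Hrho & HM0); auto; [lia|].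
  set (M := Rmax M0 0).
  assert (HMp : 0 <= M) by apply Rmax_r.
  assert (HM : forall x y, Rabs (x - fst xi) < rho -> Rabs (y - snd xi) < rho ->
    ~ Gamma (x, y) -> ex_diff_n f 2 x y /\ forall a1 a2, (a1 <= 2)%nat -> (a2 <= 2)%nat ->
    Rabs (partial_derive a1 a2 f x y) <= M).
  { intros x y Hx Hy HG. destruct (HM0 x y Hx Hy HG) as [H1 H2]. split.
    - apply (ex_diff_n_m m); [lia | exact H1].
    - intros a1 a2 Ha1 Ha2. apply Rle_trans with M0; [auto | apply Rmax_l]. }
  assert (Hsmall : forall Delta, 0 < Delta < rho / C -> 0 < C * Delta < rho).
  { intros Delta [H1 H2]. split; [apply Rmult_lt_0_compat; lra|].
    apply (Rmult_lt_compat_l C) in H2; [|exact hC].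
    replace (C * (rho / C)) with rho in H2 by (field; lra). exact H2. }
  split.
  (* [beta_bound] is used with [eps = 3 * M * h ^ 2] and [h = r * Delta]; then [eps ^ 2 / Delta ^ 2]
     is of order [Delta ^ 2]. The threshold [rho / C] keeps the radius [C * Delta] below [rho]. *)
  - exists (K * (3 * M * INR r ^ 2) ^ 2), (rho / C).
    split; [apply Rdiv_lt_0_compat; assumption|].
    intros Delta HD j i Hst P [HP Hint] Hempty.
    destruct (Hsmall Delta HD) as [HCD HCr].
    set (X := grid Delta (j + Z.of_nat k - Z.of_nat r)).
    set (Y := grid Delta (i + Z.of_nat w - Z.of_nat r)).
    set (h := INR r * Delta).
    assert (HX : grid Delta (j + Z.of_nat k) = X + h).
    { unfold X, h, grid. rewrite minus_IZR, <- (INR_IZR_INZ r). ring. }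
    assert (HY : grid Delta (i + Z.of_nat w) = Y + h).
    { unfold Y, h, grid. rewrite minus_IZR, <- (INR_IZR_INZ r). ring. }
    (* Two opposite corners of the hull lie in the disc, so the whole hull lies in the square of
       half-width [rho] about [xi], where the derivative bounds hold. *)
    assert (Hlow : disc xi (C * Delta) (X, Y)).
    { apply (Hst k w hk hw).
      exists (j + Z.of_nat k - Z.of_nat r)%Z, (i + Z.of_nat w - Z.of_nat r)%Z.
      repeat split; lia. }
    assert (Hhigh : disc xi (C * Delta) (X + h, Y + h)).
    { apply (Hst k w hk hw).
      exists (j + Z.of_nat k)%Z, (i + Z.of_nat w)%Z.
      rewrite HX, HY. repeat split; lia. }
    apply disc_coordinates in Hlow; [|exact HCD].
    apply disc_coordinates in Hhigh; [|exact HCD].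
    simpl in Hlow, Hhigh. destruct Hlow as [Hl1 Hl2]. destruct Hhigh as [Hh1 Hh2].
    apply Rabs_def2 in Hl1, Hl2, Hh1, Hh2.
    assert (Htaylor := affine_taylor_bound f X Y h M).
    set (fx := partial_derive 1 0 f X Y) in Htaylor.
    set (fy := partial_derive 0 1 f X Y) in Htaylor.
    replace (K * (3 * M * INR r ^ 2) ^ 2 * Delta ^ 2)
      with (K * (3 * M * h ^ 2) ^ 2 / Delta ^ 2) by (unfold h; field; lra).
    apply (HK Delta j i k w P (f X Y - fx * X - fy * Y) fx fy); auto; [lra | |].
    + apply Rmult_le_pos; [lra | apply pow2_ge_0].
    + intros p Hp. rewrite (Hint p Hp).
      replace (f X Y - fx * X - fy * Y + fx * fst p + fy * snd p)
        with (f X Y + fx * (fst p - X) + fy * (snd p - Y)) by ring.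
      assert (Hp' : X <= fst p <= X + h /\ Y <= snd p <= Y + h).
      { destruct Hp as (l & n & Hl & Hn & ->). rewrite <- HX, <- HY. simpl.
        unfold X, Y, grid.
        repeat split; apply Rmult_le_compat_r; try lra; apply IZR_le; lia. }
      apply Htaylor; try apply Hp'.
      intros x y Hx Hy. destruct (HM x y) as [H1 H2].
      * apply Rabs_def1; lra.
      * apply Rabs_def1; lra.
      * intros HG. apply Hempty. exists (x, y). split; [exact HG|].
        unfold stencil_hull. rewrite HX, HY. simpl. split; assumption.
      * split; [exact H1|]. intros a1 a2 Ha. apply H2; lia.
  (* Each coordinate of a node is within [C * Delta] of that of [xi], so the deviation from the
     constant [f(xi)] is at most [2 * M * C * Delta]; dividing its square by [Delta ^ 2] leaves a
     constant. *)
  - exists (K * (2 * M * C) ^ 2), (rho / C).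
    split; [apply Rdiv_lt_0_compat; assumption|].
    intros Delta HD j i Hst P [HP Hint] _.
    destruct (Hsmall Delta HD) as [HCD HCr].
    replace (K * (2 * M * C) ^ 2) with (K * (2 * M * (C * Delta)) ^ 2 / Delta ^ 2)
      by (field; lra).
    apply (HK Delta j i k w P (f (fst xi) (snd xi)) 0 0); auto; [lra | |].
    + repeat apply Rmult_le_pos; lra.
    + intros p Hp. rewrite (Hint p Hp).
      replace (f (fst xi) (snd xi) + 0 * fst p + 0 * snd p)
        with (f (fst xi) (snd xi)) by ring.
      destruct (disc_coordinates xi p (C * Delta) HCD (Hst k w hk hw p Hp)) as [H1 H2].
      eapply Rle_trans.
      * apply (lipschitz_near Gamma f xi rho M); auto; [|lra|lra].
        intros x y Hx Hy HG. destruct (HM x y Hx Hy HG) as [H3 H4].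
        split; [apply (ex_diff_n_m 2); [lia | exact H3]|].
        split; apply H4; lia.
      * nra.
Qed.
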